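(* With the notation of the context, the dual maps $\pi_4^*$, $\pi_2^*$, $\widehat{\pi_2}^*$ are described as follows. 1. $\pi_4^*$ annihilates $M$, and acts on $\pi_{4*}W$ by $\overline e_i\mapsto e_i+f_i+g_i+h_i$ ($i=1,\dots,4$), $\overline a\mapsto2a_1+2a_2$, $\overline\rho\mapsto4\rho$, $\overline\omega_1\mapsto4\omega_1$, $\overline\omega_2\mapsto4\omega_2$. Its action extends $\mathbb Q$-linearly to $\pi_{4*}H^2(X,\mathbb Z)$, which is obtained from $\pi_{4*}W$ by adding $\overline\alpha=\overline\rho/4+\overline e_1+(\overline e_2+\overline e_4)/2$, $\overline\chi=\overline\rho/2$, $\overline\zeta=\overline e_1+(\overline e_2+\overline e_4+\overline a+\overline\omega_1)/2$, $\overline\eta=\overline e_1+(\overline e_2+\overline e_4+\overline a+\overline\omega_2)/2$, and then $\mathbb Q$-linearly to the finite index overlattice $H^2(\tilde Y,\mathbb Z)$ of $\pi_{4*}H^2(X,\mathbb Z)\oplus M$. 2. $\pi_2^*$ annihilates $N$, and acts on $\pi_{2*}W$ by $\hat e_i\mapsto e_i+g_i$, $\hat f_i\mapsto f_i+h_i$ ($i=1,\dots,4$), $\hat a_j\mapsto2a_j$ ($j=1,2$), $\hat\sigma\mapsto2\sigma$, $\hat\rho\mapsto2\rho$, $\hat\omega_j\mapsto2\omega_j$ ($j=1,2$). Its action extends $\mathbb Q$-linearly to $\pi_{2*}H^2(X,\mathbb Z)$, which is obtained from $\pi_{2*}W$ by adding $\hat\alpha=(\hat\rho+\hat\sigma)/4+(\hat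 e_1+\hat e_2+\hat f_1+\hat f_4)/2$, $\hat\beta=(\hat\rho-\hat\sigma)/4+(\hat e_1+\hat e_4+\hat f_1+\hat f_2)/2$, $\hat\varepsilon=\hat\rho/2+\hat f_2+\hat f_4+(\hat a_1+\hat a_2)/2$, $\hat\chi=(\hat\rho+\hat\sigma)/2$, $\hat\zeta=(\hat e_1+\hat f_1+\hat e_4+\hat f_2+\hat a_1+\hat\omega_1)/2$, $\hat\eta=(\hat e_1+\hat f_1+\hat e_4+\hat f_2+\hat a_2+\hat\omega_2)/2$, and then $\mathbb Q$-linearly to $H^2(\tilde Z,\mathbb Z)$, obtained from $\pi_{2*}H^2(X,\mathbb Z)\oplus N$ by adding $z_1,\dots,z_6$. 3. $\widehat{\pi_2}^*$ annihilates $N_Y$, and on the generators $\overline e_1,\overline\alpha,\overline e_3,\overline e_4,\overline a,\overline\chi,\overline\zeta,\overline\eta,\widehat{\pi_2}_*n_6,\widehat{\pi_2}_*\nu,\widehat{\pi_2}_*z_1,\widehat{\pi_2}_*z_2,\widehat{\pi_2}_*z_5,\widehat{\pi_2}_*z_6$ of $\widehat{\pi_2}_*H^2(\tilde Z,\mathbb Z)$ it is given by $$\widehat{\pi_2}^*\overline e_i=\hat e_i+\hat f_i\ (i=1,\dots,4),\quad \widehat{\pi_2}^*\overline\alpha=\hat\alpha+\hat\beta,\quad \widehat{\pi_2}^*\overline a=\hat a_1+\hat a_2,\quad \widehat{\pi_2}^*\overline\chi=\widehat{\pi_2}^*\overline\rho/2=\hat\rho,$$ $$\widehat{\pi_2}^*\overline\zeta=\hat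 e_1+\hat f_1+(\hat e_2+\hat f_2+\hat e_4+\hat f_4+\hat a_1+\hat a_2+2\hat\omega_1)/2,$$ $$\widehat{\pi_2}^*\overline\eta=\hat e_1+\hat f_1+(\hat e_2+\hat f_2+\hat e_4+\hat f_4+\hat a_1+\hat a_2+2\hat\omega_2)/2,$$ $$\widehat{\pi_2}^*\widehat{\pi_2}_*n_6=2n_6,\qquad \widehat{\pi_2}^*\widehat{\pi_2}_*\nu=2\nu,$$ $$\widehat{\pi_2}^*\widehat{\pi_2}_*z_1=(\hat\alpha+\hat\beta+\hat e_1+\hat f_1+\hat e_2+\hat f_2+\hat a_1+\hat a_2+\widehat{\pi_2}^*\overline\eta+2n_2+n_5+n_8)/2,$$ $$\widehat{\pi_2}^*\widehat{\pi_2}_*z_2=(\hat\rho+\hat e_2+\hat f_2+\hat e_4+\hat f_4+\hat a_1+\hat a_2+n_3+n_4+n_5+n_8)/2,$$ $$\widehat{\pi_2}^*\widehat{\pi_2}_*z_5=(\hat\alpha+\hat\beta+\hat e_1+\hat f_1+\hat e_2+\hat f_2+\hat\rho+\widehat{\pi_2}^*\overline\eta+2n_6+n_5+n_8)/2+\hat\rho,$$ $$\widehat{\pi_2}^*\widehat{\pi_2}_*z_6=(\hat\alpha+\hat\beta+\hat e_1+\hat f_1+\hat e_4+\hat f_4+\hat\rho+\widehat{\pi_2}^*\overline\zeta+2n_7+n_5+n_8)/2+\hat a_1+\hat a_2+\hat e_2+\hat f_2+\hat\rho.$$ In particular $\widehat{\pi_2}^*\widehat{\pi_2}_*z_i=z_i+\hat\tau^*z_i$.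 The map on all of $H^2(\tilde Y,\mathbb Z)$, a finite index overlattice of $\widehat{\pi_2}_*H^2(\tilde Z,\mathbb Z)\oplus N_Y$, is obtained by $\mathbb Q$-linear extension.
   Context: Let $X$ be a K3 surface with a symplectic automorphism $\tau$ of order $4$; $\tilde Z$, $\tilde Y$ are the minimal resolutions of $X/\tau^2$ and $X/\tau$; $\tau$ induces an involution $\hat\tau$ on $\tilde Z$ and the minimal resolution of $\tilde Z/\hat\tau$ is isomorphic to $\tilde Y$. $\pi_2:X\dashrightarrow\tilde Z$, $\pi_4:X\dashrightarrow\tilde Y$, $\widehat{\pi_2}:\tilde Z\dashrightarrow\tilde Y$ are the rational quotient maps. For a rational map $\pi:S\dashrightarrow T$ resolved as $S\xleftarrow{b}S'\xrightarrow{p}T$, set $\pi_*=p_*b^*:H^2(S,\mathbb Z)\to H^2(T,\mathbb Z)$ and $\pi^*=b_*p^*:H^2(T,\mathbb Z)\to H^2(S,\mathbb Z)$ (dual to each other with respect to the intersection forms). Marking of $H^2(X,\mathbb Z)$: it contains with finite index $W=D_4^{\oplus4}\oplus A_1^{\oplus2}\oplus\langle-4\rangle\oplus\langle4\rangle\oplus\langle2\rangle\oplus\langle2\rangle$ ($D_4,A_1$ negative definite), with generators $\{e_i\},\{f_i\},\{g_i\},\{h_i\}$ of the copies of $D_4$ (third element meeting each of the others once), $a_1,a_2$, $\sigma$, $\rho$, $\omega_1,\omega_2$, such that $\tau^*:e_i\mapsto f_i\mapsto g_i\mapsto h_i\mapsto e_i$, $a_1\leftrightarrow a_2$, $\sigma\mapsto-\sigma$,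 and $\rho,\omega_1,\omega_2$ are fixed. $H^2(X,\mathbb Z)$ is generated by $W$ and $\chi=(\rho+\sigma)/2$, $\alpha=(\rho+\sigma)/4+(e_1+e_2+f_1+f_4)/2$, $\beta=\tau^*\alpha$, $\gamma=\tau^*\beta$, $\delta=\tau^*\gamma$, $\varepsilon=(\rho+f_2+f_4+h_2+h_4+a_1+a_2)/2$, $\zeta=(e_1+f_1+e_4+f_2+a_1+\omega_1)/2$, $\eta=(e_1+f_1+e_4+f_2+a_2+\omega_2)/2$. A hat denotes the image under $\pi_{2*}$ (with $\hat e_i=\pi_{2*}e_i=\pi_{2*}g_i$, $\hat f_i=\pi_{2*}f_i=\pi_{2*}h_i$) and a bar the image under $\pi_{4*}$ (with $\overline e_i=\pi_{4*}e_i=\pi_{4*}f_i=\pi_{4*}g_i=\pi_{4*}h_i$, $\overline a=\pi_{4*}a_1=\pi_{4*}a_2$). $N\subset H^2(\tilde Z,\mathbb Z)$ is the Nikulin lattice generated by the exceptional curves $n_1,\dots,n_8$ of $\tilde Z\to X/\tau^2$ and $\nu=\frac12\sum n_i$. The curves are numbered so that $H^2(\tilde Z,\mathbb Z)$ is generated by $\pi_{2*}H^2(X,\mathbb Z)\oplus N$ and $z_1=(\hat\beta+\hat f_1+\hat f_2+\hat a_2+\hat\eta)/2+(n_2+n_8)/2$, $z_2=\hat\varepsilon/2+(n_3+n_8)/2$, $z_3=\hat a_2/2+(n_4+n_8)/2$, $z_4=(\hat\varepsilon+\hat a_2+\hat\rho)/2+(n_5+n_8)/2$, $z_5=(\hat\beta+\hat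 f_1+\hat f_2+\hat\rho+\hat\chi+\hat\eta)/2+(n_6+n_8)/2$, $z_6=(\hat\beta+\hat f_1+\hat f_2+\hat\varepsilon+\hat a_2+\hat\rho+\hat\zeta)/2+(n_7+n_8)/2$. With this numbering $\hat\tau^*$ fixes $n_1,n_2,n_6,n_7$ and exchanges $n_3$ with $n_4$ and $n_5$ with $n_8$. $M\subset H^2(\tilde Y,\mathbb Z)$ is the minimal primitive sublattice containing the exceptional curves of $\tilde Y\to X/\tau$. $N_Y\subset M$ is the minimal primitive sublattice of $H^2(\tilde Y,\mathbb Z)$ containing the eight exceptional curves of the resolution $\tilde Y\to\tilde Z/\hat\tau$ (a Nikulin lattice). *)

(* Defs.v *)
From HB Require Import structures.
From mathcomp Require Import all_boot all_order all_algebra.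

Set Implicit Arguments.
Unset Strict Implicit.
Unset Printing Implicit Defensive.

Import Order.TTheory GRing.Theory Num.Theory.
Local Open Scope ring_scope.

Section Subgroups.
Variables V U : vectType rat.
Implicit Types (P Q : V -> Prop) (s : seq V).

Definition int_span s : V -> Prop := inIntSpan (in_tuple s).

Definition eq_sub P Q := forall x, P x <-> Q x.

Definition sum_sub P Q : V -> Prop :=
  fun x => exists2 y, P y & exists2 z, Q z & x = y + z.

Definition direct_sub P Q := forall x, P x -> Q x -> x = 0.

Definition img_sub (phi : 'Hom(V, U)) P : U -> Prop :=
  fun y => exists2 x, P x & y = phi x.

(* [s] lists representatives of all the cosets of [P] in [Q]. *)
Definition finite_index P Q :=
  (forall x, P x -> Q x) /\
  exists s, forall x, Q x -> exists2 r, r \in s & P (x - r).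

End Subgroups.

(* The rational cohomology H^2(S, Q) of a compact complex surface S with      *)
(* torsion-free H^2(S, Z), its intersection form, and the subgroup            *)
(* [integral] = H^2(S, Z).  Unimodularity is Poincare duality, stated as      *)
(* "H^2(S, Z) equals its own dual lattice".  Keeping the ambient rational     *)
(* space makes classes such as (rho + sigma) / 2 literal, and turns           *)
(* homomorphisms between integral classes into Q-linear maps preserving       *)
(* integrality.                                                               *)
Record lattice := Lattice {
  ambient :> vectType rat;
  ip : {symmetric ambient};
  integral : ambient -> Prop;
  integral_basis : exists B : seq ambient,
    basis_of fullv B /\ eq_sub integral (int_span B);
  unimodular : forall x,
    integral x <-> (forall y, integral y -> ip x y \is a Num.int)
}.

Definition K3_lattice (L : lattice) :=
  [/\ \dim {:L} = 22%N,
      forall x : L, integral x -> exists k : int, ip L x x = (2 * k)%:~R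
    & exists B : seq L,
        [/\ basis_of fullv B, pairwise (fun x y => ip L x y == 0) B,
            count (fun x => 0 < ip L x x) B = 3%N
          & count (fun x => ip L x x < 0) B = 19%N]].

Definition sublattice (L : lattice) (P : L -> Prop) :=
  [/\ forall x, P x -> integral x, P 0 & forall x y, P x -> P y -> P (x - y)].

Definition primitive (L : lattice) (P : L -> Prop) :=
  sublattice P /\
  forall (k : nat) x, (0 < k)%N -> integral x -> P (x *+ k) -> P x.

(* The minimal primitive sublattice containing the classes in [s]. *)
Definition primitive_closure (L : lattice) (s : seq L) : L -> Prop :=
  fun x => forall P, primitive P -> (forall c, c \in s -> P c) -> P x.

(* The action on H^2 of an automorphism of order d. *)
Definition isometry_of_order (L : lattice) (g : 'End(L)) (d : nat) :=
  [/\ forall x, integral x -> integral (g x),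
      forall x y, ip L (g x) (g y) = ip L x y,
      forall x, iter d g x = x
    & forall k, (0 < k < d)%N -> exists x, iter k g x <> x].

(* Pull-back and push-forward on H^2 along a generically finite holomorphic   *)
(* map S -> T of degree d.                                                    *)
Record gen_finite_map (S T : lattice) (d : nat) := GenFiniteMap {
  pull : 'Hom(T, S);
  push : 'Hom(S, T);
  pull_integral : forall y, integral y -> integral (pull y);
  push_integral : forall x, integral x -> integral (push x);
  push_adjoint : forall x y, ip T (push x) y = ip S x (pull y);
  push_pull : forall y, push (pull y) = d%:R *: y
}.

(* Classes of the exceptional curves of the minimal resolution of a surface   *)
(* with rational double points: (-2)-curves, two of which meet at most once.  *)
Definition exceptional_curves (T : lattice) (E : seq T) :=
  [/\ free E, forall c, c \in E -> integral c,
      forall c, c \in E -> ip T c c = - 2%:R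
    & forall c c', c \in E -> c' \in E -> c != c' ->
        (ip T c c' == 0) || (ip T c c' == 1)].

(* The rational quotient map S --> T, where T is the minimal resolution of    *)
(* S/G for a cyclic group G of order d whose generator acts on H^2(S) by g,   *)
(* and where E lists the exceptional curves of T -> S/G.  It is resolved as   *)
(*            S <-- blow_down -- roof -- covering --> T                       *)
(* by a G-equivariant sequence of blow-ups and a generically finite map of    *)
(* degree d, invariant under the action [deck] of the generator on the roof.  *)
(* - The curves contracted by [blow_down] are [exc]; they span the kernel of  *)
(*   its push-forward.                                                        *)
(* - The curves of [E] lie over points of S/G, so their inverse images are    *)
(*   supported on [exc]; conversely the image of a curve of [exc] is          *)
(*   contracted in S/G, hence supported on [E].                               *)
(* - [covering] is the quotient by G up to contracted curves: by the          *)
(*   isomorphism H^2(roof/G, Q) = H^2(roof, Q)^G, every invariant rational    *)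
(*   class of the roof comes from T up to [exc].                              *)
Record quotient_map (S T : lattice) (g : 'End(S)) (d : nat) (E : seq T) :=
  QuotientMap {
  E_exceptional : exceptional_curves E;
  roof : lattice;
  blow_down : gen_finite_map roof S 1;
  covering : gen_finite_map roof T d;
  exc : seq roof;
  exc_span : <<exc>>%VS = lker (push blow_down);
  deck : 'End(roof);
  deck_isometry : isometry_of_order deck d;
  deck_blow_down : forall x, deck (pull blow_down x) = pull blow_down (g x);
  deck_cover : forall y, deck (pull covering y) = pull covering y;
  pull_E : forall c, c \in E -> pull covering c \in <<exc>>%VS;
  push_exc : forall c, c \in exc -> push covering c \in <<E>>%VS;
  invariants : forall x, deck x = x ->
    exists y : T, x - pull covering y \in <<exc>>%VS
}.

(* The push-forward p_* b^* and the pull-back b_* p^* of S <-b- roof -p-> T.  *)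
Section RationalMap.
Variables (S T : lattice) (g : 'End(S)) (d : nat) (E : seq T).
Variable q : quotient_map g d E.

Definition rpush : 'Hom(S, T) := (push (covering q) \o pull (blow_down q))%VF.
Definition rpull : 'Hom(T, S) := (push (blow_down q) \o pull (covering q))%VF.

End RationalMap.

(* Indexed families start at 1: e_1, ..., e_4, a_1, a_2, n_1, ..., n_8.       *)
(* Values at other indices are irrelevant.                                    *)
Record frame (V : Type) := Frame {
  e_ : nat -> V;
  f_ : nat -> V;
  g_ : nat -> V;
  h_ : nat -> V;
  a_ : nat -> V;
  sigma : V;
  rho : V;
  omega_ : nat -> V
}.

Definition D4_gram (i j : nat) : rat :=
  if i == j then - 2%:R else if (i == 3%N) || (j == 3%N) then 1 else 0.

Section Marking.
Variables (X : lattice) (tau : 'End(X)) (w : frame X).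

Definition W_blocks : seq (seq X) :=
  [:: [seq e_ w i | i <- iota 1 4]; [seq f_ w i | i <- iota 1 4];
      [seq g_ w i | i <- iota 1 4]; [seq h_ w i | i <- iota 1 4];
      [:: a_ w 1]; [:: a_ w 2]; [:: sigma w]; [:: rho w];
      [:: omega_ w 1]; [:: omega_ w 2]].

Definition W_basis : seq X := flatten W_blocks.

Definition chiX : X := 2^-1 *: (rho w + sigma w).
Definition alphaX : X :=
  4^-1 *: (rho w + sigma w) + 2^-1 *: (e_ w 1 + e_ w 2 + f_ w 1 + f_ w 4).
Definition betaX : X := tau alphaX.
Definition gammaX : X := tau betaX.
Definition deltaX : X := tau gammaX.
Definition epsilonX : X :=
  2^-1 *: (rho w + f_ w 2 + f_ w 4 + h_ w 2 + h_ w 4 + a_ w 1 + a_ w 2).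
Definition zetaX : X :=
  2^-1 *: (e_ w 1 + f_ w 1 + e_ w 4 + f_ w 2 + a_ w 1 + omega_ w 1).
Definition etaX : X :=
  2^-1 *: (e_ w 1 + f_ w 1 + e_ w 4 + f_ w 2 + a_ w 2 + omega_ w 2).

Record marking : Prop := Marking {
  W_orthogonal : pairwise (allrel (fun x y => ip X x y == 0)) W_blocks;
  W_D4 : forall i j, (1 <= i <= 4)%N -> (1 <= j <= 4)%N ->
    [/\ ip X (e_ w i) (e_ w j) = D4_gram i j,
        ip X (f_ w i) (f_ w j) = D4_gram i j,
        ip X (g_ w i) (g_ w j) = D4_gram i j
      & ip X (h_ w i) (h_ w j) = D4_gram i j];
  W_A1 : ip X (a_ w 1) (a_ w 1) = - 2%:R /\ ip X (a_ w 2) (a_ w 2) = - 2%:R;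
  W_rank1 : [/\ ip X (sigma w) (sigma w) = - 4%:R,
                ip X (rho w) (rho w) = 4%:R,
                ip X (omega_ w 1) (omega_ w 1) = 2%:R
              & ip X (omega_ w 2) (omega_ w 2) = 2%:R];
  tau_D4 : forall i, (1 <= i <= 4)%N ->
    [/\ tau (e_ w i) = f_ w i, tau (f_ w i) = g_ w i,
        tau (g_ w i) = h_ w i & tau (h_ w i) = e_ w i];
  tau_A1 : tau (a_ w 1) = a_ w 2 /\ tau (a_ w 2) = a_ w 1;
  tau_rank1 : [/\ tau (sigma w) = - sigma w, tau (rho w) = rho w,
                  tau (omega_ w 1) = omega_ w 1
                & tau (omega_ w 2) = omega_ w 2];
  marking_generated : eq_sub (@integral X)
    (int_span (W_basis ++
       [:: chiX; alphaX; betaX; gammaX; deltaX; epsilonX; zetaX; etaX]))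
}.

End Marking.

Definition eight (V : Type) (n : nat -> V) : seq V := [seq n i | i <- iota 1 8].

Definition half_sum (V : vectType rat) (n : nat -> V) : V :=
  2^-1 *: \sum_(1 <= i < 9) n i.

(* The Nikulin lattice spanned by eight disjoint (-2)-curves and their        *)
(* half sum.                                                                  *)
Definition nikulin_lattice (V : vectType rat) (n : nat -> V) : V -> Prop :=
  int_span (rcons (eight n) (half_sum n)).

Definition nikulin_curves (L : lattice) (n : nat -> L) :=
  (forall i j, (1 <= i <= 8)%N -> (1 <= j <= 8)%N ->
     ip L (n i) (n j) = if i == j then - 2%:R else 0) /\
  integral (half_sum n).

(* The classes z_1, ..., z_6 of the intermediate quotient, where [hat] is the *)
(* push-forward along X --> Z and n_1, ..., n_8 are the exceptional curves.   *)
Section GlueClasses.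
Variables (X Z : lattice) (tau : 'End(X)) (w : frame X).
Variables (hat : 'Hom(X, Z)) (n : nat -> Z).
Local Notation beta := (betaX tau w).
Local Notation epsilon := (epsilonX w).

Definition z_ (i : nat) : Z :=
  match i with
  | 1 => 2^-1 *: (hat beta + hat (f_ w 1) + hat (f_ w 2) + hat (a_ w 2)
                  + hat (etaX w))
         + 2^-1 *: (n 2%N + n 8%N)
  | 2 => 2^-1 *: hat epsilon + 2^-1 *: (n 3%N + n 8%N)
  | 3 => 2^-1 *: hat (a_ w 2) + 2^-1 *: (n 4%N + n 8%N)
  | 4 => 2^-1 *: (hat epsilon + hat (a_ w 2) + hat (rho w))
         + 2^-1 *: (n 5%N + n 8%N)
  | 5 => 2^-1 *: (hat beta + hat (f_ w 1) + hat (f_ w 2) + hat (rho w)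
                  + hat (chiX w) + hat (etaX w))
         + 2^-1 *: (n 6%N + n 8%N)
  | 6 => 2^-1 *: (hat beta + hat (f_ w 1) + hat (f_ w 2) + hat epsilon
                  + hat (a_ w 2) + hat (rho w) + hat (zetaX w))
         + 2^-1 *: (n 7%N + n 8%N)
  | _ => 0
  end.

End GlueClasses.

(* Main.v *)
Require Import Defs.
From mathcomp Require Import all_boot all_order all_algebra.
From mathcomp Require Import lra.

(* Let p = rpush q be the push-forward of a cyclic quotient of degree d, g    *)
(* the generator, E the exceptional curves.  Modulo the curves contracted on  *)
(* the roof, pulling back a push-forward is the trace sum_(k < d) deck^k, so  *)
(* p^* p_* = sum_(k < d) g^k.  As d y - p_* p^* y is supported on E and p^*   *)
(* kills E, the map p^* is determined by its values on p_*; the formulas are  *)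
(* then traces of explicit classes.  Finite index holds because d, up to a    *)
(* factor 2 for the Nikulin lattice, multiplies the integral classes into the *)
(* direct sum.  In part 3, the generators not listed are recovered through    *)
(* z_3 = z_2 - alpha + e_1 and z_4 = chi + alpha - e_1 + a + n_8 in H^2(Y).   *)

Set Implicit Arguments.
Unset Strict Implicit.
Unset Printing Implicit Defensive.

Import Order.TTheory GRing.Theory Num.Theory.
Local Open Scope ring_scope.

(** * Subgroups of rational vector spaces *)

(** All three rational maps are quotients by a cyclic group, so one argument serves for them. Write
    p_* for [rpush q], p^* for [rpull q], d for the degree and g for the action of the generator. On
    the roof, the trace of a class under the deck group is invariant, hence a pull-back up to
    contracted curves; blowing down gives p^* p_* = 1 + g + ... + g^(d-1) ([rpull_rpush]).
    Conversely d y - p_* p^* y lies in the rational span of the exceptional curves ([rpush_rpull]),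
    which p^* kills ([rpull_span_E]). So p^* is the only linear map that vanishes on those curves
    and is the trace on the image of p_* ([eq_rpush_E]). The same two relations show that this image
    meets the span of the curves only in 0 ([rpush_span_E]) and that the two together have finite
    index ([rpush_finite_index]).

    The rest is explicit. The values of the dual maps are traces of marked classes under [tau], its
    square, or [tauh]. The image lattices ([hat_integral], [bar_integral], [push_integral_basis])
    come from pushing forward generators of the source: classes in one orbit become equal, and the
    generators that have become integer combinations of others are dropped. *)

Section LinearMaps.
Variables V U : vectType rat.

Lemma lfun_eq_span (phi psi : 'Hom(V, U)) (s : seq V) :
  {in s, phi =1 psi} -> {in <<s>>%VS, phi =1 psi}.
Proof.
move=> eq_s x; suff /subvP sub: (<<s>> <= lker (phi - psi))%VS.
  by move/sub; rewrite memv_ker add_lfunE opp_lfunE subr_eq0 => /eqP.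
apply/span_subvP=> c /eq_s.
by rewrite memv_ker add_lfunE opp_lfunE subr_eq0 => ->.
Qed.

(** Coordinates in a basis are linear forms, so linear forms separate vectors. This turns vector
    identities into rational ones, within reach of [lra]. *)
Lemma scalar_ext (x y : V) : (forall F : {scalar V}, F x = F y) -> x = y.
Proof.
move=> eq_xy; rewrite (coord_vbasis (memvf x)) (coord_vbasis (memvf y)).
by apply: eq_bigr => i _; congr (_ *: _); apply: eq_xy.
Qed.

(** Bundled for [rewrite]: fixing [phi] confines the expansion to one map. *)
Definition linear_lfun (phi : 'Hom(V, U)) :=
  (linearD phi : {morph phi : x y / x + y},
   linearN phi : {morph phi : x / - x},
   linearZZ phi : forall k, {morph phi : x / k *: x},
   (fun k => linearMn phi k) : forall k, {morph phi : x / x *+ k}).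

End LinearMaps.

(** Under an arbitrary linear form the atoms become free rational variables, and linear arithmetic
    remains. *)
Ltac linear_eq :=
  let F := fresh "F" in
  apply: scalar_ext => F;
  rewrite ?(linear0 F, linearD F, linearN F, scalarZ F, linearMn F);
  repeat (let a := fresh "a" in move: (F _) => a);
  lra.

Definition subgroup (V : zmodType) (P : V -> Prop) :=
  P 0 /\ forall x y, P x -> P y -> P (x - y).

Section Subgroups.
Variables V U : vectType rat.
Implicit Types (P Q : V -> Prop) (s : seq V).

Section Closure.
Variable P : V -> Prop.
Hypothesis gP : subgroup P.

Lemma subgroupN x : P x -> P (- x).
Proof. by move=> Px; rewrite -sub0r; apply: gP.2 => //; apply: gP.1. Qed.

Lemma subgroupD x y : P x -> P y -> P (x + y).
Proof. by move=> Px Py; rewrite -[y]opprK; apply/gP.2/subgroupN. Qed.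

Lemma subgroupMn x k : P x -> P (x *+ k).
Proof.
move=> Px; elim: k => [|k IH]; first by rewrite mulr0n; apply: gP.1.
by rewrite mulrS; apply: subgroupD.
Qed.

Lemma subgroupMz x (k : int) : P x -> P (x *~ k).
Proof.
by case: k => k Px; rewrite ?NegzE ?mulrNz; [|apply: subgroupN];
  rewrite -pmulrn; apply: subgroupMn.
Qed.

Lemma subgroup_sum (I : Type) (r : seq I) (F : I -> V) :
  (forall i, P (F i)) -> P (\sum_(i <- r) F i).
Proof.
by move=> PF; apply: big_ind => //; [apply: gP.1 | apply: subgroupD].
Qed.

Lemma int_span_min s :
  (forall c, c \in s -> P c) -> forall x, int_span s x -> P x.
Proof.
move=> Ps _ [a ->]; apply: subgroup_sum => i; apply: subgroupMz.
by apply: Ps; rewrite mem_nth.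
Qed.

End Closure.

Lemma int_span_subgroup s : subgroup (int_span s).
Proof.
split=> [|_ _ [a ->] [b ->]].
  by exists [ffun=> 0]; rewrite big1 // => i _; rewrite ffunE mulr0z.
exists [ffun i => a i - b i]; rewrite -sumrB.
by apply: eq_bigr => i _; rewrite ffunE mulrzBr.
Qed.

Lemma mem_int_span s c : c \in s -> int_span s c.
Proof.
move=> sc; have lt_c: (index c s < size s)%N by rewrite index_mem.
exists [ffun i => (i == Ordinal lt_c)%:R]; rewrite (bigD1 (Ordinal lt_c)) //=.
rewrite big1 => [|i /negPf nic]; rewrite ffunE ?eqxx ?nic ?mulr0z //.
by rewrite mulr1z addr0 nth_index.
Qed.

Lemma int_span_span s x : int_span s x -> x \in <<s>>%VS.
Proof.
move=> [a ->]; apply: rpred_sum => i _; apply: rpredMz.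
by rewrite memv_span ?mem_nth.
Qed.

Lemma int_span_coord s x :
  free s -> int_span s x -> forall i, coord (in_tuple s) i x \is a Num.int.
Proof.
move=> free_s [a ->] i; rewrite linear_sum; apply: rpred_sum => j _.
rewrite raddfMz rpredMz //=.
by have /= -> := coord_free j i (X := in_tuple s) free_s; apply: rpred_nat.
Qed.

Lemma span_int_span s x :
  x \in <<s>>%VS -> exists2 k, (0 < k)%N & int_span s (x *+ k).
Proof.
move=> sx; rewrite (coord_span (X := in_tuple s) sx).
pose multiple y := exists2 k, (0 < k)%N & int_span s (y *+ k).
(* Denominators are cleared one summand at a time; for a sum, the product of the two multipliers
   works. *)
apply: (big_ind multiple) => [|y z [k k0 Pk] [l l0 Pl]|i _].
- by exists 1%N => //; apply: (int_span_subgroup s).1.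
- exists (k * l)%N; first by rewrite muln_gt0 k0.
  rewrite mulrnDl; apply: (subgroupD (int_span_subgroup s)).
    by rewrite mulrnA; apply: (subgroupMn (int_span_subgroup s)).
  by rewrite mulnC mulrnA; apply: (subgroupMn (int_span_subgroup s)).
- set c := coord _ _ _; exists `|denq c|%N; first by rewrite absz_gt0 denq_neq0.
  rewrite scalerMnl -mulr_natr pmulrn absz_denq -numqE scaler_int.
  by apply: (subgroupMz (int_span_subgroup s)); apply/mem_int_span/mem_nth.
Qed.

Lemma sum_subgroup P Q : subgroup P -> subgroup Q -> subgroup (sum_sub P Q).
Proof.
move=> gP gQ; split=> [|_ _ [y Py [z Qz ->]] [y' Py' [z' Qz' ->]]].
  by exists 0; [apply: gP.1 | exists 0; [apply: gQ.1 | rewrite addr0]].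
exists (y - y'); first exact: gP.2.
by exists (z - z'); [apply: gQ.2 | rewrite opprD addrACA].
Qed.

Lemma sum_subl P Q x : subgroup Q -> P x -> sum_sub P Q x.
Proof.
by move=> gQ Px; exists x => //; exists 0; [apply: gQ.1 | rewrite addr0].
Qed.

Lemma sum_subr P Q x : subgroup P -> Q x -> sum_sub P Q x.
Proof. by move=> gP Qx; exists 0; [apply: gP.1 | exists x; rewrite ?add0r]. Qed.

Lemma img_subgroup (phi : 'Hom(V, U)) P :
  subgroup P -> subgroup (img_sub phi P).
Proof.
move=> gP; split=> [|_ _ [x Px ->] [y Py ->]].
  by exists 0; [apply: gP.1 | rewrite linear0].
by exists (x - y); [apply: gP.2 | rewrite linearB].
Qed.

Lemma preim_subgroup (phi : 'Hom(V, U)) (R : U -> Prop) :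
  subgroup R -> subgroup (fun x => R (phi x)).
Proof.
move=> gR; split=> [|x y Rx Ry]; first by rewrite linear0; apply: gR.1.
by rewrite linearB; apply: gR.2.
Qed.

Lemma equalizer_subgroup (phi psi : 'Hom(V, U)) :
  subgroup (fun x => phi x = psi x).
Proof.
by split=> [|x y eq_x eq_y]; rewrite ?linear0 // !linearB /= eq_x eq_y.
Qed.

End Subgroups.

Ltac subgroup_mem gP :=
  repeat first [assumption | apply: (subgroupD gP) | apply: (subgroupN gP)
               | apply: (subgroupMn gP)].

(** * Nondegeneracy, primitive closures and finite index in a unimodular lattice *)

Section Lattices.
Variable L : lattice.
Implicit Types (x y : L) (P : L -> Prop) (s : seq L).

Lemma integral_subgroup : subgroup (@integral L).
Proof.
have [B [_ intB]] := integral_basis L.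
have [g0 gB] := int_span_subgroup B.
by split=> [|x y /intB Bx /intB By]; apply/intB; [apply: g0 | apply: gB].
Qed.

Lemma span_integral x : exists2 k, (0 < k)%N & integral (x *+ k).
Proof.
have [B [basisB intB]] := integral_basis L.
have [|k k0 Bx] := @span_int_span _ B x.
  by rewrite (span_basis basisB) memvf.
by exists k => //; apply/intB.
Qed.

Lemma eq_integral (U : vectType rat) (phi psi : 'Hom(L, U)) :
  (forall x, integral x -> phi x = psi x) -> phi = psi.
Proof.
move=> eq_int; apply/lfunP => x; have [k k0 /eq_int] := span_integral x.
by rewrite !linearMn -!scaler_nat; apply: scalerI; rewrite pnatr_eq0 -lt0n.
Qed.

Lemma ipC x y : ip L x y = ip L y x.
Proof. by rewrite hermC expr0 mul1r. Qed.

(** If [x] is orthogonal to everything, so are all its rational multiples, and unimodularity makes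
    each of them integral. A nonzero coordinate could then be scaled to 1/2, which is not an
    integer. *)
Lemma ip_eq0 x : (forall y, ip L x y = 0) -> x = 0.
Proof.
move=> x0; have [B [basisB intB]] := integral_basis L.
have coord_int (c : rat) i : c * coord (in_tuple B) i x \is a Num.int.
  rewrite -linearZ; apply: int_span_coord (basis_free basisB) _ i.
  apply/intB/unimodular => y _.
  by rewrite ipC linearZ /= -ipC x0 mulr0.
have xB : x \in <<in_tuple B>>%VS by rewrite (span_basis basisB) memvf.
rewrite (coord_span xB) big1 // => i _.
case: (eqVneq (coord (in_tuple B) i x) 0) => [->|nz]; first by rewrite scale0r.
have := coord_int (2^-1 / coord (in_tuple B) i x) i.
by rewrite divfK.
Qed.

Lemma primitive_integral_vspace (A : {vspace L}) :
  primitive (fun x => integral x /\ x \in A).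
Proof.
have [int0 intB] := integral_subgroup.
split; first split=> [x [] //||x y [ix Ax] [iy Ay]].
- by split; rewrite ?mem0v.
- by split; [apply: intB | rewrite rpredB].
move=> k x k0 ix [_ Ax]; split=> //.
by move: Ax; rewrite -scaler_nat rpredZeq pnatr_eq0 (gtn_eqF k0).
Qed.

(** The integral classes of a rational subspace form a primitive sublattice, which bounds the
    closure from above. Conversely, some positive multiple of [x] is an integer combination of [s],
    so every primitive [P] containing [s] contains [x]. *)
Lemma primitive_closureP s x : {in s, forall c, integral c} ->
  primitive_closure s x <-> integral x /\ x \in <<s>>%VS.
Proof.
move=> int_s; split=> [Mx|[ix sx] P [[_ P0 PB] primP] sP].
  apply: (Mx (fun y => integral y /\ y \in <<s>>%VS)).
    exact: primitive_integral_vspace.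
  by move=> c sc; split; [apply: int_s | apply: memv_span].
have [k k0 kx] := span_int_span sx.
by apply: (primP k) => //; apply: int_span_min kx => //; split.
Qed.

(** Divide the integer coordinates by k with remainder: the quotients contribute k times an integral
    class, which is in [P], and only finitely many remainder vectors occur. *)
Lemma finite_index_multiple P k : (0 < k)%N -> subgroup P ->
  (forall x, P x -> integral x) -> (forall x, integral x -> P (x *+ k)) ->
  finite_index P (@integral L).
Proof.
case: k => // k _ gP P_int kP; split=> //.
have [B [basisB intB]] := integral_basis L.
pose rep (f : {ffun 'I_(size B) -> 'I_k.+1}) := \sum_(i < size B) B`_i *+ f i.
exists (codom rep) => x /intB [a ->].
pose q := \sum_(i < size B) B`_i *~ (a i %/ k.+1)%Z.
pose r : {ffun 'I_(size B) -> 'I_k.+1} :=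
  [ffun i => inord `|(a i %% k.+1)%Z|%N].
exists (rep r).
  exact: codom_f.
suff -> : \sum_(i < size B) B`_i *~ a i - rep r = q *+ k.+1.
  apply/kP/intB; exists [ffun i => (a i %/ k.+1)%Z].
  by apply: eq_bigr => i _; rewrite ffunE.
rewrite /rep -sumrB -sumrMnl; apply: eq_bigr => i _; rewrite ffunE.
have r0 := modz_ge0 (a i) (isT : k.+1%:Z != 0).
rewrite inordK; last first.
  by rewrite -ltz_nat gez0_abs // ltz_pmod.
rewrite pmulrn gez0_abs // -mulrzBr {1}(divz_eq (a i) k.+1) addrK mulrzA.
by rewrite pmulrn.
Qed.

End Lattices.

(** * Rational quotient maps *)

Section RationalQuotient.
Variables (S T : lattice) (g : 'End(S)) (d : nat) (E : seq T).
Variable q : quotient_map g d E.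
Hypothesis d_gt0 : (0 < d)%N.

Lemma rpush_integral x : integral x -> integral (rpush q x).
Proof. by move=> ix; rewrite comp_lfunE; apply/push_integral/pull_integral. Qed.

Lemma rpull_integral y : integral y -> integral (rpull q y).
Proof. by move=> iy; rewrite comp_lfunE; apply/push_integral/pull_integral. Qed.

(** After adjunction, the pairing with [y] is computed on the roof against the deck-invariant
    pull-back of [y]. Since [deck] is an isometry, it can be removed from the other argument;
    nondegeneracy concludes. *)
Lemma rpush_invariant x : rpush q (g x) = rpush q x.
Proof.
rewrite !comp_lfunE /= -deck_blow_down; apply/eqP; rewrite -subr_eq0; apply/eqP.
apply: ip_eq0 => y; have [_ isom _ _] := deck_isometry q.
by rewrite linearBl /= !push_adjoint -{1}(deck_cover q) isom subrr.
Qed.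

Lemma rpull_span_E y : y \in <<E>>%VS -> rpull q y = 0.
Proof.
move=> Ey; apply/eqP; rewrite -memv_ker; move: y Ey; apply/subvP/span_subvP.
move=> c /(pull_E q); rewrite exc_span memv_ker => /eqP c0.
by rewrite memv_ker comp_lfunE c0.
Qed.

Lemma push_span_exc r : r \in <<exc q>>%VS -> push (covering q) r \in <<E>>%VS.
Proof.
move=> qr; rewrite memv_preim; move: r qr; apply/subvP/span_subvP => c.
by rewrite -memv_preim; apply: push_exc.
Qed.

Lemma pull_span_E y : y \in <<E>>%VS -> pull (covering q) y \in <<exc q>>%VS.
Proof.
move=> Ey; rewrite memv_preim; move: y Ey; apply/subvP/span_subvP => c.
by rewrite -memv_preim; apply: pull_E.
Qed.

(* The trace of r is deck-invariant, so up to exceptional classes it is the   *)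
(* pull-back of some y, and pushing forward identifies y with the image of r. *)
Lemma pull_push_trace r :
  pull (covering q) (push (covering q) r) - \sum_(k < d) iter k (deck q) r
    \in <<exc q>>%VS.
Proof.
have [_ isom ord _] := deck_isometry q.
set s := \sum_(k < d) _.
have s_inv : deck q s = s.
  (* The deck transformation shifts the summands cyclically. With [r] added, both sides are the sum
     of the first d + 1 iterates, as the d-th iterate is [r] again. *)
  apply: (addrI r); rewrite /s linear_sum.
  rewrite -(big_ord_recl d (fun k => iter k (deck q) r)).
  by rewrite big_ord_recr /= ord addrC.
have push_deck k : push (covering q) (iter k (deck q) r) = push (covering q) r.
  elim: k => //= k <-; apply/eqP; rewrite -subr_eq0; apply/eqP/ip_eq0 => y.
  by rewrite linearBl /= !push_adjoint -{1}(deck_cover q) isom subrr.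
have [y sy] := invariants s_inv.
have : d%:R *: (push (covering q) r - y) \in <<E>>%VS.
  rewrite scalerBr -(push_pull (covering q) y).
  suff -> : d%:R *: push (covering q) r = push (covering q) s.
    by rewrite -linearB; apply: push_span_exc.
  rewrite linear_sum /=; under eq_bigr do rewrite push_deck.
  by rewrite sumr_const card_ord scaler_nat.
rewrite rpredZeq pnatr_eq0 (gtn_eqF d_gt0) => /pull_span_E.
by rewrite linearB /= -(rpredBr _ sy) // opprB addrA subrK.
Qed.

(** Blowing down kills the error term of [pull_push_trace], and [deck] acts on pull-backs from S as
    [g] does; the blow-down has degree 1, so it undoes its own pull-back. *)
Lemma rpull_rpush x : rpull q (rpush q x) = \sum_(k < d) iter k g x.
Proof.
have deck_iter k :
    iter k (deck q) (pull (blow_down q) x) = pull (blow_down q) (iter k g x).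
  by elim: k => //= k ->; apply: deck_blow_down.
have := pull_push_trace (pull (blow_down q) x).
rewrite exc_span memv_ker linearB subr_eq0 !comp_lfunE => /eqP ->.
under eq_bigr do rewrite deck_iter.
by rewrite -linear_sum /= push_pull scale1r.
Qed.

(** Pulling [y] back to the roof, blowing down and pulling back again changes the class only by
    contracted curves, whose images are supported on [E]. Without that detour, pushing forward would
    give exactly d times [y]. *)
Lemma rpush_rpull y : y *+ d - rpush q (rpull q y) \in <<E>>%VS.
Proof.
rewrite -scaler_nat -(push_pull (covering q)) !comp_lfunE -linearB.
apply: push_span_exc; rewrite exc_span memv_ker linearB /=.
by rewrite push_pull scale1r subrr.
Qed.

(** The pull-back of such a class is 0, so the trace of [x] is 0; pushing the trace forward gives d
    times the class itself. *)
Lemma rpush_span_E x : rpush q x \in <<E>>%VS -> rpush q x = 0.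
Proof.
move=> Ex; have := rpull_span_E Ex; rewrite rpull_rpush => /(congr1 (rpush q)).
have inv k : rpush q (iter k g x) = rpush q x.
  by elim: k => //= k <-; apply: rpush_invariant.
rewrite linear0 linear_sum /=; under eq_bigr do rewrite inv.
rewrite sumr_const card_ord => /eqP.
by rewrite -scaler_nat scaler_eq0 pnatr_eq0 (gtn_eqF d_gt0) => /eqP.
Qed.

(** By [rpush_rpull], d times any class is a push-forward plus a combination of exceptional curves.
    This is the source of all the uniqueness claims. *)
Lemma eq_rpush_E (U : vectType rat) (phi psi : 'Hom(T, U)) :
  {in E, phi =1 psi} -> (forall x, phi (rpush q x) = psi (rpush q x)) ->
  phi = psi.
Proof.
move=> eqE eq_push; apply/lfunP => y.
have := lfun_eq_span eqE (rpush_rpull y).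
rewrite !linearB !linearMn /= eq_push => /addIr.
by rewrite -!scaler_nat; apply: scalerI; rewrite pnatr_eq0 -lt0n.
Qed.

Lemma rpush_direct (P : T -> Prop) : (forall y, P y -> y \in <<E>>%VS) ->
  direct_sub (img_sub (rpush q) (@integral S)) P.
Proof. by move=> PE _ [x _ ->] /PE; apply: rpush_span_E. Qed.

(** Multiply the decomposition d y = p_* p^* y + (exceptional part) by k: the first term is the
    image of an integral class and the second falls into [P]. The factor k allows [P] to be smaller
    than the group of all integral classes in the span of [E]. *)
Lemma rpush_finite_index (P : T -> Prop) k : (0 < k)%N -> subgroup P ->
  (forall y, P y -> integral y) ->
  (forall y, integral y -> y \in <<E>>%VS -> P (y *+ k)) ->
  finite_index (sum_sub (img_sub (rpush q) (@integral S)) P) (@integral T).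
Proof.
move=> k0 gP P_int PE; have gI := img_subgroup (rpush q) (integral_subgroup S).
apply: (@finite_index_multiple _ _ (d * k))
  => [||_ [_ [x ix ->] [z Pz ->]]|y iy].
- by rewrite muln_gt0 d_gt0.
- exact: sum_subgroup.
- apply: (subgroupD (integral_subgroup T)); last exact: P_int.
  exact: rpush_integral.
have ipy : integral (rpush q (rpull q y)).
  exact/rpush_integral/rpull_integral.
exists (rpush q (rpull q y) *+ k).
  by apply: subgroupMn => //; exists (rpull q y) => //; apply: rpull_integral.
exists ((y *+ d - rpush q (rpull q y)) *+ k).
  apply: PE (rpush_rpull y); apply: (integral_subgroup T).2 => //.
  by apply: subgroupMn => //; apply: integral_subgroup.
by rewrite -mulrnDl addrC subrK mulrnA.
Qed.

Lemma primitive_closureE y :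
  primitive_closure E y <-> integral y /\ y \in <<E>>%VS.
Proof. by apply: primitive_closureP; case: (E_exceptional q). Qed.

Lemma mem_primitive_closure c : c \in E -> primitive_closure E c.
Proof. by move=> Ec P _; apply. Qed.

Lemma rpull_primitive_closure y : primitive_closure E y -> rpull q y = 0.
Proof. by move/primitive_closureE=> [_]; apply: rpull_span_E. Qed.

Lemma primitive_closure_finite_index :
  direct_sub (img_sub (rpush q) (@integral S)) (primitive_closure E) /\
  finite_index (sum_sub (img_sub (rpush q) (@integral S)) (primitive_closure E))
    (@integral T).
Proof.
split; first by apply: rpush_direct => // y /primitive_closureE [].
(* The primitive closure already holds every integral class in the span of [E], so the factor is
   1. *)
apply: (@rpush_finite_index _ 1) => // [|y /primitive_closureE []|] //.
  split=> [|x y Px Py P primP sP].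
    by move=> P [[]].
  by case: (primP) => [[_ _ PB] _]; apply: PB; [apply: Px | apply: Py].
by move=> y iy Ey; apply/primitive_closureE.
Qed.

End RationalQuotient.

(** * The marking *)

Section MarkedLattice.
Variables (X : lattice) (tau : 'End(X)) (w : frame X).
Hypothesis mk : marking tau w.

Lemma tau_e i : (1 <= i <= 4)%N -> tau (e_ w i) = f_ w i.
Proof. by case/(tau_D4 mk). Qed.

Lemma tau_f i : (1 <= i <= 4)%N -> tau (f_ w i) = g_ w i.
Proof. by case/(tau_D4 mk). Qed.

Lemma tau_g i : (1 <= i <= 4)%N -> tau (g_ w i) = h_ w i.
Proof. by case/(tau_D4 mk). Qed.

Lemma tau_h i : (1 <= i <= 4)%N -> tau (h_ w i) = e_ w i.
Proof. by case/(tau_D4 mk). Qed.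

Lemma tau_a1 : tau (a_ w 1) = a_ w 2. Proof. by case: (tau_A1 mk). Qed.
Lemma tau_a2 : tau (a_ w 2) = a_ w 1. Proof. by case: (tau_A1 mk). Qed.
Lemma tau_sigma : tau (sigma w) = - sigma w.
Proof. by case: (tau_rank1 mk). Qed.
Lemma tau_rho : tau (rho w) = rho w. Proof. by case: (tau_rank1 mk). Qed.
Lemma tau_omega1 : tau (omega_ w 1) = omega_ w 1.
Proof. by case: (tau_rank1 mk). Qed.
Lemma tau_omega2 : tau (omega_ w 2) = omega_ w 2.
Proof. by case: (tau_rank1 mk). Qed.

Definition tau_frame :=
  (tau_e, tau_f, tau_g, tau_h, tau_a1, tau_a2, tau_sigma, tau_rho, tau_omega1,
   tau_omega2).

Lemma betaXE : betaX tau w =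
  4^-1 *: (rho w - sigma w) + 2^-1 *: (f_ w 1 + f_ w 2 + g_ w 1 + g_ w 4).
Proof. by rewrite /betaX /alphaX !linear_lfun !tau_frame //; linear_eq. Qed.

Lemma gammaXE : gammaX tau w =
  4^-1 *: (rho w + sigma w) + 2^-1 *: (g_ w 1 + g_ w 2 + h_ w 1 + h_ w 4).
Proof. by rewrite /gammaX betaXE !linear_lfun !tau_frame //; linear_eq. Qed.

Lemma deltaXE : deltaX tau w =
  4^-1 *: (rho w - sigma w) + 2^-1 *: (h_ w 1 + h_ w 2 + e_ w 1 + e_ w 4).
Proof. by rewrite /deltaX gammaXE !linear_lfun !tau_frame //; linear_eq. Qed.

Lemma W_basis_D4 i : (1 <= i <= 4)%N ->
  [/\ e_ w i \in W_basis w, f_ w i \in W_basis w, g_ w i \in W_basis w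
    & h_ w i \in W_basis w].
Proof.
move=> i14; have iota_i : i \in iota 1 4 by rewrite mem_iota.
by split; apply/flattenP; [exists [seq e_ w j | j <- iota 1 4]
  | exists [seq f_ w j | j <- iota 1 4] | exists [seq g_ w j | j <- iota 1 4]
  | exists [seq h_ w j | j <- iota 1 4]]; rewrite ?map_f // !inE eqxx ?orbT.
Qed.

Lemma W_basis_A1 :
  {subset [:: a_ w 1; a_ w 2; sigma w; rho w; omega_ w 1; omega_ w 2]
    <= W_basis w}.
Proof.
(* The four copies of D4 occupy the first sixteen places of the list. *)
by move=> c Wc; rewrite -[W_basis w](cat_take_drop 16) mem_cat orbC Wc.
Qed.

Lemma W_basis_ind (P : X -> Prop) :
  (forall i, (1 <= i <= 4)%N ->
     [/\ P (e_ w i), P (f_ w i), P (g_ w i) & P (h_ w i)]) ->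
  P (a_ w 1) -> P (a_ w 2) -> P (sigma w) -> P (rho w) ->
  P (omega_ w 1) -> P (omega_ w 2) ->
  forall c, c \in W_basis w -> P c.
Proof.
move=> D4 a1 a2 s r o1 o2 c /flattenP[b]; rewrite !inE.
do 4![case/orP=> [/eqP-> /mapP[i]|];
  first by rewrite mem_iota => i14 ->; case: (D4 i i14)].
do 5![case/orP=> [/eqP->|]; first by rewrite inE => /eqP->].
by move/eqP->; rewrite inE => /eqP->.
Qed.

Lemma integral_W c : c \in W_basis w -> integral c.
Proof.
move=> Wc; apply/(marking_generated mk); apply: mem_int_span.
by rewrite mem_cat Wc.
Qed.

Lemma integral_glue :
  [/\ integral (chiX w), integral (alphaX w), integral (betaX tau w) &
   [/\ integral (epsilonX w), integral (zetaX w) & integral (etaX w)]].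
Proof.
have int c : c \in [:: chiX w; alphaX w; betaX tau w; gammaX tau w;
    deltaX tau w; epsilonX w; zetaX w; etaX w] -> integral c.
  move=> Xc; apply/(marking_generated mk)/mem_int_span.
  by rewrite mem_cat Xc orbT.
by split; [..|split]; apply: int; rewrite !inE eqxx ?orbT.
Qed.

(** The glue classes are rational combinations of W, so W spans all integral classes, and every
    class has an integral multiple. *)
Lemma span_W x : x \in <<W_basis w>>%VS.
Proof.
have [k k0 kx] := span_integral x.
suff: x *+ k \in <<W_basis w>>%VS.
  by rewrite -scaler_nat rpredZeq pnatr_eq0 (gtn_eqF k0).
move/(marking_generated mk): kx => /int_span_span; apply/subvP/span_subvP => c.
have sW c' : c' \in W_basis w -> c' \in <<W_basis w>>%VS by apply: memv_span.
rewrite mem_cat => /orP[/sW //|].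
suff /allP sub : all (mem <<W_basis w>>%VS)
  [:: chiX w; alphaX w; betaX tau w; gammaX tau w; deltaX tau w; epsilonX w;
      zetaX w; etaX w] by apply: sub.
have [e1 f1 g1 h1] := W_basis_D4 (isT : 1 <= 1 <= 4)%N.
have [e2 f2 g2 h2] := W_basis_D4 (isT : 1 <= 2 <= 4)%N.
have [e4 f4 g4 h4] := W_basis_D4 (isT : 1 <= 4 <= 4)%N.
have /allP/and5P[a1 a2 s r /and3P[o1 o2 _]] := W_basis_A1.
rewrite /= betaXE gammaXE deltaXE.
by rewrite !(rpredD, rpredN, rpredZ) ?sW.
Qed.

Lemma eq_comp_W_basis (T U : vectType rat) (hat : 'Hom(X, T))
    (phi psi : 'Hom(T, U)) :
  (forall c, c \in W_basis w -> phi (hat c) = psi (hat c)) ->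
  forall x, phi (hat x) = psi (hat x).
Proof.
move=> eqW x; rewrite -!comp_lfunE; apply: lfun_eq_span (span_W x) => c /eqW.
by rewrite !comp_lfunE.
Qed.

Lemma push_integral_min (U : vectType rat) (phi : 'Hom(X, U)) (P : U -> Prop) :
  subgroup P -> (forall c, c \in W_basis w -> P (phi c)) ->
  [/\ P (phi (chiX w)), P (phi (alphaX w)), P (phi (betaX tau w)) &
   [/\ P (phi (gammaX tau w)), P (phi (deltaX tau w)), P (phi (epsilonX w)),
      P (phi (zetaX w)) & P (phi (etaX w))]] ->
  forall x, integral x -> P (phi x).
Proof.
move=> gP PW [P1 P2 P3 [P4 P5 P6 P7 P8]] x /(marking_generated mk).
apply: (int_span_min (preim_subgroup phi gP)) => c.
rewrite mem_cat => /orP[/PW //|].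
by rewrite !inE; do 7?[case/orP=> [/eqP->|] //]; move/eqP->.
Qed.

(** * Images under a map invariant under the square of [tau]; this covers both [hat] and [bar] *)

Section SquareInvariant.
Variables (U : vectType rat) (hat : 'Hom(X, U)).
Hypothesis hat_tau2 : forall x, hat (tau (tau x)) = hat x.

Lemma hat_g i : (1 <= i <= 4)%N -> hat (g_ w i) = hat (e_ w i).
Proof. by move=> i14; rewrite -[RHS]hat_tau2 tau_e // tau_f. Qed.

Lemma hat_h i : (1 <= i <= 4)%N -> hat (h_ w i) = hat (f_ w i).
Proof. by move=> i14; rewrite -[RHS]hat_tau2 tau_f // tau_g. Qed.

Lemma hat_alpha : hat (alphaX w) = 4^-1 *: (hat (rho w) + hat (sigma w))
  + 2^-1 *: (hat (e_ w 1) + hat (e_ w 2) + hat (f_ w 1) + hat (f_ w 4)).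
Proof. by rewrite /alphaX !linear_lfun; linear_eq. Qed.

Lemma hat_beta : hat (betaX tau w) = 4^-1 *: (hat (rho w) - hat (sigma w))
  + 2^-1 *: (hat (e_ w 1) + hat (e_ w 4) + hat (f_ w 1) + hat (f_ w 2)).
Proof. by rewrite betaXE !linear_lfun !hat_g //; linear_eq. Qed.

Lemma hat_gamma : hat (gammaX tau w) = hat (alphaX w).
Proof. exact: hat_tau2. Qed.

Lemma hat_delta : hat (deltaX tau w) = hat (betaX tau w).
Proof. exact: hat_tau2. Qed.

Lemma hat_epsilon : hat (epsilonX w) =
  2^-1 *: hat (rho w) + hat (f_ w 2) + hat (f_ w 4)
  + 2^-1 *: (hat (a_ w 1) + hat (a_ w 2)).
Proof. by rewrite /epsilonX !linear_lfun !hat_h //; linear_eq. Qed.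

Lemma hat_chi : hat (chiX w) = 2^-1 *: (hat (rho w) + hat (sigma w)).
Proof. by rewrite /chiX !linear_lfun; linear_eq. Qed.

Lemma hat_zeta : hat (zetaX w) = 2^-1 *: (hat (e_ w 1) + hat (f_ w 1)
  + hat (e_ w 4) + hat (f_ w 2) + hat (a_ w 1) + hat (omega_ w 1)).
Proof. by rewrite /zetaX !linear_lfun; linear_eq. Qed.

Lemma hat_eta : hat (etaX w) = 2^-1 *: (hat (e_ w 1) + hat (f_ w 1)
  + hat (e_ w 4) + hat (f_ w 2) + hat (a_ w 2) + hat (omega_ w 2)).
Proof. by rewrite /etaX !linear_lfun; linear_eq. Qed.

(** Of the eight glue classes six remain, because gamma and delta have the images of alpha and
    beta. *)
Lemma hat_integral : eq_sub (img_sub hat (@integral X))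
  (sum_sub (img_sub hat (int_span (W_basis w)))
     (int_span [:: hat (alphaX w); hat (betaX tau w); hat (epsilonX w);
                   hat (chiX w); hat (zetaX w); hat (etaX w)])).
Proof.
set s := [:: _; _; _; _; _; _] => x.
have gI := img_subgroup hat (integral_subgroup X).
have gW := img_subgroup hat (int_span_subgroup (W_basis w)).
have gS := sum_subgroup gW (int_span_subgroup s).
split=> [[y iy ->]|[_ [v Wv ->] [u su ->]]].
  apply: (push_integral_min gS) iy => [c Wc|].
    apply: sum_subl (int_span_subgroup _) _.
    by exists c => //; apply: mem_int_span.
  by split; [..|split]; apply: sum_subr gW _; apply: mem_int_span;
    rewrite ?hat_gamma ?hat_delta !inE eqxx ?orbT.
apply: (subgroupD gI).
  exists v => //; apply: int_span_min Wv; first exact: integral_subgroup.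
  exact: integral_W.
apply: (int_span_min gI) su => c.
have [i1 i2 i3 [i4 i5 i6]] := integral_glue.
by rewrite !inE; do 5?[case/orP=> [/eqP->|]]; try move/eqP->;
  refine (ex_intro2 _ _ _ _ erefl).
Qed.

End SquareInvariant.

(** * Images under a map invariant under [tau] itself *)

Section Invariant.
Variables (U : vectType rat) (bar : 'Hom(X, U)).
Hypothesis bar_tau : forall x, bar (tau x) = bar x.

Let bar_tau2 x : bar (tau (tau x)) = bar x.
Proof. by rewrite !bar_tau. Qed.

Lemma bar_f i : (1 <= i <= 4)%N -> bar (f_ w i) = bar (e_ w i).
Proof. by move=> i14; rewrite -tau_e. Qed.

Lemma bar_g i : (1 <= i <= 4)%N -> bar (g_ w i) = bar (e_ w i).
Proof. by move=> i14; rewrite -tau_f // bar_tau bar_f. Qed.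

Lemma bar_h i : (1 <= i <= 4)%N -> bar (h_ w i) = bar (e_ w i).
Proof. by move=> i14; rewrite -tau_g // bar_tau bar_g. Qed.

Lemma bar_a2 : bar (a_ w 2) = bar (a_ w 1).
Proof. by rewrite -tau_a1. Qed.

(** As [tau] negates [sigma], the image equals its own negative. *)
Lemma bar_sigma : bar (sigma w) = 0.
Proof.
have := bar_tau (sigma w); rewrite tau_sigma linearN => /eqP.
by rewrite -subr_eq0 -opprD oppr_eq0 -mulr2n -scaler_nat scaler_eq0 => /eqP.
Qed.

Lemma bar_alpha : bar (alphaX w) =
  4^-1 *: bar (rho w) + bar (e_ w 1) + 2^-1 *: (bar (e_ w 2) + bar (e_ w 4)).
Proof. by rewrite hat_alpha bar_sigma !bar_f //; linear_eq. Qed.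

Lemma bar_beta : bar (betaX tau w) = bar (alphaX w).
Proof. exact: bar_tau. Qed.

Lemma bar_chi : bar (chiX w) = 2^-1 *: bar (rho w).
Proof. by rewrite hat_chi bar_sigma addr0. Qed.

Lemma bar_epsilon : bar (epsilonX w) =
  2^-1 *: bar (rho w) + bar (e_ w 2) + bar (e_ w 4) + bar (a_ w 1).
Proof. by rewrite hat_epsilon // bar_a2 !bar_f //; linear_eq. Qed.

Lemma bar_zeta : bar (zetaX w) = bar (e_ w 1)
  + 2^-1 *: (bar (e_ w 2) + bar (e_ w 4) + bar (a_ w 1) + bar (omega_ w 1)).
Proof. by rewrite hat_zeta !bar_f //; linear_eq. Qed.

Lemma bar_eta : bar (etaX w) = bar (e_ w 1)
  + 2^-1 *: (bar (e_ w 2) + bar (e_ w 4) + bar (a_ w 1) + bar (omega_ w 2)).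
Proof. by rewrite hat_eta bar_a2 !bar_f //; linear_eq. Qed.

(** Refines [hat_integral]: beta now has the image of alpha, and the image of epsilon is that of chi
    plus images of W, so neither is needed as a generator. *)
Lemma bar_integral : eq_sub (img_sub bar (@integral X))
  (sum_sub (img_sub bar (int_span (W_basis w)))
     (int_span [:: bar (alphaX w); bar (chiX w); bar (zetaX w);
                   bar (etaX w)])).
Proof.
set s := [:: _; _; _; _] => x; split=> [/(hat_integral bar_tau2)|].
  case=> _ [v Wv ->] [u su ->].
  have gW := img_subgroup bar (int_span_subgroup (W_basis w)).
  have gS := sum_subgroup gW (int_span_subgroup s).
  set R := sum_sub _ _ in gS *.
  have Ws c : c \in W_basis w -> R (bar c).
    move=> Wc; apply: sum_subl (int_span_subgroup _) _.
    by exists c => //; apply: mem_int_span.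
  have ss k : (k < 4)%N -> R s`_k.
    by move=> lt_k; apply: sum_subr gW _; apply/mem_int_span/mem_nth.
  apply: (subgroupD gS).
    by apply: sum_subl (int_span_subgroup _) _; exists v.
  apply: (int_span_min gS) su => c; rewrite bar_beta.
  have [e2 _ _ _] := W_basis_D4 (isT : 1 <= 2 <= 4)%N.
  have [e4 _ _ _] := W_basis_D4 (isT : 1 <= 4 <= 4)%N.
  have /allP/and3P[a1 _ _] := W_basis_A1.
  have [/= s0 s1 s2 s3] := And4 (ss 0 isT) (ss 1 isT) (ss 2 isT) (ss 3 isT).
  rewrite !inE; do 5?[case/orP=> [/eqP->|] //]; try move/eqP-> => //.
  rewrite bar_epsilon -bar_chi.
  by subgroup_mem gS; apply: Ws.
case=> _ [v Wv ->] [u su ->]; apply/(hat_integral bar_tau2).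
exists (bar v); first by exists v.
exists u => //; apply: (int_span_min (int_span_subgroup _)) su => c sc.
apply: mem_int_span; move: sc; rewrite !inE.
by case/or4P=> /eqP->; rewrite eqxx ?orbT.
Qed.

End Invariant.
End MarkedLattice.

(** * The Nikulin lattice and the induced involution *)

Section Nikulin.
Variables (L : lattice) (n : nat -> L).

Lemma eightP (c : L) :
  c \in eight n -> exists2 i, (1 <= i <= 8)%N & c = n i.
Proof. by case/mapP=> i; rewrite mem_iota => i18 ->; exists i. Qed.

Lemma mem_eight i : (1 <= i <= 8)%N -> n i \in eight n.
Proof. by move=> i18; rewrite map_f // mem_iota. Qed.

Lemma nikulin_mem i : (1 <= i <= 8)%N -> nikulin_lattice n (n i).
Proof.
by move=> i18; apply: mem_int_span; rewrite mem_rcons inE mem_eight ?orbT.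
Qed.

Lemma half_sum_span : half_sum n \in <<eight n>>%VS.
Proof.
rewrite rpredZ // big_seq; apply: rpred_sum => i.
by rewrite mem_index_iota => i18; apply/memv_span/mem_eight.
Qed.

Lemma nikulin_span y : nikulin_lattice n y -> y \in <<eight n>>%VS.
Proof.
move/int_span_span; apply/subvP/span_subvP => c.
rewrite mem_rcons inE => /orP[/eqP->|]; first exact: half_sum_span.
exact: memv_span.
Qed.

Hypothesis nikulin_n : nikulin_curves n.
Hypothesis int_n : {in eight n, forall c, integral c}.

Lemma nikulin_integral y : nikulin_lattice n y -> integral y.
Proof.
apply: (int_span_min (integral_subgroup L)) => c.
by rewrite mem_rcons inE => /orP[/eqP->|/int_n //]; case: nikulin_n.
Qed.

(* Pairing with n_i shows that the coefficients of y lie in Z/2. *)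
Lemma nikulin_double y :
  integral y -> y \in <<eight n>>%VS -> nikulin_lattice n (y *+ 2).
Proof.
move=> iy ny; have := coord_span (X := in_tuple (eight n)) ny.
set c := coord _ => Dy.
(* List positions count from 0, the curves from 1. *)
have nE (i : 'I_8) : (eight n)`_i = n i.+1.
  by rewrite (nth_map 0%N) ?size_iota // nth_iota.
have c_int i : 2 * c i y \is a Num.int.
  suff -> : 2 * c i y = - ip L y (n i.+1).
    rewrite rpredN; move/unimodular: iy; apply; apply: int_n.
    by rewrite mem_eight // (ltn_ord i).
  have [ip_n _] := nikulin_n.
  rewrite ipC [in RHS]Dy linear_sum (bigD1 i) //= big1 => [|j /negPf nji].
    by rewrite linearZ /= nE ip_n ?(ltn_ord i) // eqxx addr0 mulrN opprK mulrC.
  rewrite linearZ /= nE ip_n ?(ltn_ord i) ?(ltn_ord j) // eqSS eq_sym.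
  by rewrite -val_eqE /= in nji; rewrite nji mulr0.
rewrite Dy -sumrMnl; apply: (subgroup_sum (int_span_subgroup _)) => i.
rewrite -scaler_nat scalerA; have /intrP[k ->] := c_int i.
rewrite scaler_int; apply: (subgroupMz (int_span_subgroup _)).
by rewrite nE; apply: nikulin_mem; rewrite (ltn_ord i).
Qed.

End Nikulin.

(** * The induced involution: its image lattice and its traces *)

Section InducedInvolution.
Variables (X Z : lattice) (tau : 'End(X)) (w : frame X) (hat : 'Hom(X, Z)).
Variables (n : nat -> Z) (tauh : 'End(Z)).
Hypothesis mk : marking tau w.
Hypothesis hat_tau2 : forall x, hat (tau (tau x)) = hat x.
Hypothesis tauh_hat : forall x, tauh (hat x) = hat (tau x).
Hypothesis tauh_swapped : [/\ tauh (n 3%N) = n 4%N, tauh (n 4%N) = n 3%N,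
  tauh (n 5%N) = n 8%N & tauh (n 8%N) = n 5%N].

Local Notation z := (z_ tau w hat n).

Section Pushforward.
Variables (U : vectType rat) (push : 'Hom(Z, U)).
Hypothesis push_tauh : forall y, push (tauh y) = push y.
Hypothesis integral_hat : forall x, integral x -> integral (hat x).
Hypothesis integral_n : forall i, (1 <= i <= 8)%N -> integral (n i).
Hypothesis integral_half_sum : integral (half_sum n).
Hypothesis generated_Z : eq_sub (@integral Z)
  (sum_sub (sum_sub (img_sub hat (@integral X)) (nikulin_lattice n))
     (int_span [seq z i | i <- iota 1 6])).

Variable bar : 'Hom(X, U).
Hypothesis barE : forall x, push (hat x) = bar x.

Let bar_tau x : bar (tau x) = bar x.
Proof. by rewrite -!barE -tauh_hat push_tauh. Qed.

Let bar_basis := (bar_alpha mk bar_tau, bar_beta w bar_tau, bar_chi mk bar_tau,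
  bar_epsilon mk bar_tau, bar_zeta mk bar_tau, bar_eta mk bar_tau,
  bar_a2 mk bar_tau).

Lemma integral_z i : (1 <= i <= 6)%N -> integral (z i).
Proof.
move=> i16; apply/generated_Z; apply: sum_subr.
  apply: sum_subgroup; last exact: int_span_subgroup.
  exact/img_subgroup/integral_subgroup.
by apply/mem_int_span/map_f; rewrite mem_iota.
Qed.

(** The push-forward is [tauh]-invariant, so n_3 and n_4 have one image, as do n_5 and n_8, and
    images of X are governed by [bar_integral]. Each generator of the integral classes of Z then
    becomes an integer combination of the fourteen, found by solving the defining formulas of alpha,
    zeta, eta, the half sum and the z_i for the missing class. *)
Lemma push_integral_basis : eq_sub (img_sub push (@integral Z))
  (int_span [:: bar (e_ w 1); bar (alphaX w); bar (e_ w 3); bar (e_ w 4);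
                bar (a_ w 1); bar (chiX w); bar (zetaX w); bar (etaX w);
                push (n 6%N); push (half_sum n); push (z 1%N); push (z 2%N);
                push (z 5%N); push (z 6%N)]).
Proof.
set s := [:: _, _ & _]; have gS := int_span_subgroup s.
have S k : (k < 14)%N -> int_span s s`_k.
  by move=> lt_k; apply/mem_int_span/mem_nth.
have [/= e1 al e3 e4] := And4 (S 0 isT) (S 1 isT) (S 2 isT) (S 3 isT).
have [/= a ch ze et] := And4 (S 4 isT) (S 5 isT) (S 6 isT) (S 7 isT).
have [/= n6 nu z1 z2] := And4 (S 8 isT) (S 9 isT) (S 10 isT) (S 11 isT).
have [/= z5 z6] := conj (S 12 isT) (S 13 isT).
have gZ := img_subgroup push (integral_subgroup Z).
have [i_ch i_al i_be [i_ep i_ze i_et]] := integral_glue mk.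
have int_bar x : integral x -> img_sub push (@integral Z) (bar x).
  by move=> ix; exists (hat x); [apply: integral_hat | rewrite barE].
move=> y; split=> [[v /generated_Z]|]; last first.
  apply: (int_span_min gZ) => c.
  have int_push u : integral u -> img_sub push (@integral Z) (push u).
    by exists u.
  have int_W c' : c' \in W_basis w -> img_sub push (@integral Z) (bar c').
    by move/(integral_W mk)/int_bar.
  have [W1 _ _ _] := W_basis_D4 w (isT : 1 <= 1 <= 4)%N.
  have [W3 _ _ _] := W_basis_D4 w (isT : 1 <= 3 <= 4)%N.
  have [W4 _ _ _] := W_basis_D4 w (isT : 1 <= 4 <= 4)%N.
  have /allP/and3P[Wa _ _] := @W_basis_A1 _ w.
  rewrite !inE; do 13?[case/orP=> [/eqP->|]]; try move/eqP->;
    first [exact: int_W | exact: int_bar | apply: int_push];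
    by [apply: integral_n | apply: integral_z |].
have e2 : int_span s (bar (e_ w 2)).
  rewrite (_ : bar _ = bar (alphaX w) *+ 2 - bar (chiX w) - bar (e_ w 1) *+ 2
    - bar (e_ w 4)); last by rewrite !bar_basis; linear_eq.
  by subgroup_mem gS.
have rh : int_span s (bar (rho w)).
  rewrite (_ : bar _ = bar (chiX w) *+ 2); last first.
    by rewrite !bar_basis; linear_eq.
  by subgroup_mem gS.
have o1 : int_span s (bar (omega_ w 1)).
  rewrite (_ : bar _ = bar (zetaX w) *+ 2 - bar (e_ w 1) *+ 2 - bar (e_ w 2)
    - bar (e_ w 4) - bar (a_ w 1)); last by rewrite !bar_basis; linear_eq.
  by subgroup_mem gS.
have o2 : int_span s (bar (omega_ w 2)).
  rewrite (_ : bar _ = bar (etaX w) *+ 2 - bar (e_ w 1) *+ 2 - bar (e_ w 2)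
    - bar (e_ w 4) - bar (a_ w 1)); last by rewrite !bar_basis; linear_eq.
  by subgroup_mem gS.
have bar_s x : integral x -> int_span s (bar x).
  move=> ix; have : img_sub bar (@integral X) (bar x) by exists x.
  case/(bar_integral mk bar_tau)=> _ [v' Wv ->] [u su ->].
  apply: (subgroupD gS).
    apply: (int_span_min (preim_subgroup bar gS)) Wv.
    apply: W_basis_ind => //.
    - case=> [|[|[|[|[|//]]]]] // i14;
        rewrite (bar_f mk bar_tau) // (bar_g mk bar_tau) //;
        by rewrite (bar_h mk bar_tau).
    - by rewrite (bar_a2 mk bar_tau).
    - by rewrite (bar_sigma mk bar_tau); apply: gS.1.
  apply: (int_span_min gS) su => c.
  by rewrite !inE; case/or4P=> /eqP->.
have pn4 : push (n 4%N) = push (n 3%N).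
  by case: tauh_swapped => <-.
have pn5 : push (n 5%N) = push (n 8%N).
  by case: tauh_swapped => _ _ _ <-.
have f1 : bar (f_ w 1) = bar (e_ w 1) by rewrite (bar_f mk bar_tau).
have f2 : bar (f_ w 2) = bar (e_ w 2) by rewrite (bar_f mk bar_tau).
(* Doubling z_5 clears its halves and isolates n_8 among known classes; then z_1, z_2 and z_6 yield
   n_2, n_3 and n_7 in the same way. *)
have n8 : int_span s (push (n 8%N)).
  rewrite (_ : push _ = push (z 5%N) *+ 2 - bar (alphaX w) - bar (e_ w 1)
    - bar (e_ w 2) - bar (chiX w) *+ 3 - bar (etaX w) - push (n 6%N));
    last first.
    by rewrite /z_ !(linear_lfun push) !barE f1 f2 !bar_basis; linear_eq.
  by subgroup_mem gS.
have n2 : int_span s (push (n 2%N)).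
  rewrite (_ : push _ = push (z 1%N) *+ 2 - bar (alphaX w) - bar (e_ w 1)
    - bar (e_ w 2) - bar (a_ w 1) - bar (etaX w) - push (n 8%N)); last first.
    by rewrite /z_ !(linear_lfun push) !barE f1 f2 !bar_basis; linear_eq.
  by subgroup_mem gS.
have n3 : int_span s (push (n 3%N)).
  rewrite (_ : push _ = push (z 2%N) *+ 2 - bar (epsilonX w) - push (n 8%N));
    last first.
    by rewrite /z_ !(linear_lfun push) !barE; linear_eq.
  by subgroup_mem gS; apply: bar_s.
have n7 : int_span s (push (n 7%N)).
  rewrite (_ : push _ = push (z 6%N) *+ 2 - bar (betaX tau w) - bar (e_ w 1)
    - bar (e_ w 2) - bar (epsilonX w) - bar (a_ w 1) - bar (rho w)
    - bar (zetaX w) - push (n 8%N)); last first.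
    rewrite /z_ !(linear_lfun push) !barE f1 f2 (bar_a2 mk bar_tau).
    by linear_eq.
  by subgroup_mem gS; apply: bar_s.
(* In twice the half sum, the swapped pairs contribute twice n_3 and twice n_8, and n_1 is the only
   unknown. *)
have n1 : int_span s (push (n 1%N)).
  rewrite (_ : push _ = push (half_sum n) *+ 2 - push (n 2%N)
    - push (n 3%N) *+ 2 - push (n 8%N) *+ 2 - push (n 6%N) - push (n 7%N));
    last first.
    rewrite /half_sum /index_iota /= !big_cons big_nil addr0.
    by rewrite !(linear_lfun push) pn4 pn5; linear_eq.
  by subgroup_mem gS.
(* The curves cancel in z_3 - z_2 since n_3 and n_4 have the same image; in z_4 the halves of n_5
   and n_8 add up to n_8. *)
have z3 : int_span s (push (z 3%N)).
  rewrite (_ : push _ = push (z 2%N) - bar (alphaX w) + bar (e_ w 1));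
    last first.
    by rewrite /z_ !(linear_lfun push) !barE !bar_basis pn4; linear_eq.
  by subgroup_mem gS.
have z4 : int_span s (push (z 4%N)).
  rewrite (_ : push _ = bar (chiX w) + bar (alphaX w) - bar (e_ w 1)
    + bar (a_ w 1) + push (n 8%N)); last first.
    by rewrite /z_ !(linear_lfun push) !barE !bar_basis pn5; linear_eq.
  by subgroup_mem gS.
case=> _ [_ [x ix ->] [u Nu ->]] [t zt ->] ->; rewrite !linearD /= barE.
have gpush := preim_subgroup push gS.
apply: (subgroupD gS); first apply: (subgroupD gS); first exact: bar_s.
  apply: (int_span_min gpush) Nu => c.
  rewrite mem_rcons inE => /orP[/eqP-> //|].
  by case/eightP; do 9?[case=> //]; move=> _ -> //; rewrite ?pn4 ?pn5.
apply: (int_span_min gpush) zt => c; rewrite !inE.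
by do 5?[case/orP=> [/eqP->|] //]; move/eqP->.
Qed.

End Pushforward.

(** * Traces under the induced involution *)

Lemma tauh_beta : tauh (hat (betaX tau w)) = hat (alphaX w).
Proof. by rewrite tauh_hat -[RHS]hat_tau2. Qed.

Lemma tauh_f i : (1 <= i <= 4)%N -> tauh (hat (f_ w i)) = hat (e_ w i).
Proof. by move=> i14; rewrite tauh_hat (tau_f mk) // (hat_g mk). Qed.

Lemma tauh_a2 : tauh (hat (a_ w 2)) = hat (a_ w 1).
Proof. by rewrite tauh_hat (tau_a2 mk). Qed.

Lemma tauh_rho : tauh (hat (rho w)) = hat (rho w).
Proof. by rewrite tauh_hat (tau_rho mk). Qed.

Lemma trace_epsilon : hat (epsilonX w) + tauh (hat (epsilonX w)) =
  hat (rho w) + hat (e_ w 2) + hat (f_ w 2) + hat (e_ w 4) + hat (f_ w 4)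
  + hat (a_ w 1) + hat (a_ w 2).
Proof.
rewrite tauh_hat /epsilonX !(linear_lfun tau) !(tau_frame mk) //.
rewrite !(linear_lfun hat) !(hat_g mk hat_tau2) //.
by rewrite !(hat_h mk hat_tau2) //; linear_eq.
Qed.

Lemma trace_chi : hat (chiX w) + tauh (hat (chiX w)) = hat (rho w).
Proof.
rewrite tauh_hat /chiX !(linear_lfun tau) !(tau_frame mk) //.
by rewrite !(linear_lfun hat); linear_eq.
Qed.

Lemma trace_zeta : hat (zetaX w) + tauh (hat (zetaX w)) =
  hat (e_ w 1) + hat (f_ w 1)
  + 2^-1 *: (hat (e_ w 2) + hat (f_ w 2) + hat (e_ w 4) + hat (f_ w 4)
             + hat (a_ w 1) + hat (a_ w 2) + 2%:R *: hat (omega_ w 1)).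
Proof.
rewrite tauh_hat /zetaX !(linear_lfun tau) !(tau_frame mk) //.
rewrite !(linear_lfun hat) !(hat_g mk hat_tau2) //.
by linear_eq.
Qed.

Lemma trace_eta : hat (etaX w) + tauh (hat (etaX w)) =
  hat (e_ w 1) + hat (f_ w 1)
  + 2^-1 *: (hat (e_ w 2) + hat (f_ w 2) + hat (e_ w 4) + hat (f_ w 4)
             + hat (a_ w 1) + hat (a_ w 2) + 2%:R *: hat (omega_ w 2)).
Proof.
rewrite tauh_hat /etaX !(linear_lfun tau) !(tau_frame mk) //.
rewrite !(linear_lfun hat) !(hat_g mk hat_tau2) //.
by linear_eq.
Qed.


Lemma trace_e i : (1 <= i <= 4)%N ->
  hat (e_ w i) + tauh (hat (e_ w i)) = hat (e_ w i) + hat (f_ w i).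
Proof. by move=> i14; rewrite tauh_hat (tau_e mk). Qed.

(** The trace of eta stays unexpanded because it is the value of the dual map at the image of eta,
    the form in which the final formula is stated. The same holds for z_5, and for zeta in z_6. *)
Lemma trace_z1 : tauh (n 2%N) = n 2%N -> z 1%N + tauh (z 1%N) =
  2^-1 *: (hat (alphaX w) + hat (betaX tau w) + hat (e_ w 1) + hat (f_ w 1)
           + hat (e_ w 2) + hat (f_ w 2) + hat (a_ w 1) + hat (a_ w 2)
           + (hat (etaX w) + tauh (hat (etaX w)))
           + 2%:R *: n 2%N + n 5%N + n 8%N).
Proof.
case: tauh_swapped => _ _ _ n8 n2.
rewrite /z_ !(linear_lfun tauh) n2 n8 tauh_beta !tauh_f // tauh_a2.
by linear_eq.
Qed.

Lemma trace_z2 : z 2%N + tauh (z 2%N) =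
  2^-1 *: (hat (rho w) + hat (e_ w 2) + hat (f_ w 2) + hat (e_ w 4)
           + hat (f_ w 4) + hat (a_ w 1) + hat (a_ w 2)
           + n 3%N + n 4%N + n 5%N + n 8%N).
Proof.
case: tauh_swapped => n3 _ _ n8.
(* The trace identity is solved for the conjugate of epsilon and substituted. *)
rewrite /z_ !(linear_lfun tauh) n3 n8 (canRL (addKr _) trace_epsilon).
by linear_eq.
Qed.

Lemma trace_z5 : tauh (n 6%N) = n 6%N -> z 5%N + tauh (z 5%N) =
  2^-1 *: (hat (alphaX w) + hat (betaX tau w) + hat (e_ w 1) + hat (f_ w 1)
           + hat (e_ w 2) + hat (f_ w 2) + hat (rho w)
           + (hat (etaX w) + tauh (hat (etaX w)))
           + 2%:R *: n 6%N + n 5%N + n 8%N)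
  + hat (rho w).
Proof.
case: tauh_swapped => _ _ _ n8 n6.
rewrite /z_ !(linear_lfun tauh) n6 n8 (canRL (addKr _) trace_chi).
rewrite tauh_beta !tauh_f // tauh_rho.
by linear_eq.
Qed.

Lemma trace_z6 : tauh (n 7%N) = n 7%N -> z 6%N + tauh (z 6%N) =
  2^-1 *: (hat (alphaX w) + hat (betaX tau w) + hat (e_ w 1) + hat (f_ w 1)
           + hat (e_ w 4) + hat (f_ w 4) + hat (rho w)
           + (hat (zetaX w) + tauh (hat (zetaX w)))
           + 2%:R *: n 7%N + n 5%N + n 8%N)
  + hat (a_ w 1) + hat (a_ w 2) + hat (e_ w 2) + hat (f_ w 2) + hat (rho w).
Proof.
case: tauh_swapped => _ _ _ n8 n7.
rewrite /z_ !(linear_lfun tauh) n7 n8 (canRL (addKr _) trace_epsilon).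
rewrite tauh_beta !tauh_f // tauh_a2 tauh_rho.
by linear_eq.
Qed.

(** The involution permutes the eight curves and therefore fixes their half sum. *)
Lemma trace_half_sum : [/\ tauh (n 1%N) = n 1%N, tauh (n 2%N) = n 2%N,
    tauh (n 6%N) = n 6%N & tauh (n 7%N) = n 7%N] ->
  half_sum n + tauh (half_sum n) = 2%:R *: half_sum n.
Proof.
case: tauh_swapped => n3 n4 n5 n8 [n1 n2 n6 n7].
rewrite /half_sum /index_iota /= !big_cons big_nil addr0 !(linear_lfun tauh).
by rewrite n1 n2 n3 n4 n5 n6 n7 n8; linear_eq.
Qed.

End InducedInvolution.

(** * The three dual maps *)

Theorem proposition4p4p1
  (X Z Y : lattice)
  (K3_X : K3_lattice X) (K3_Z : K3_lattice Z) (K3_Y : K3_lattice Y)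
  (tau : 'End(X)) (tau_order4 : isometry_of_order tau 4)
  (tauh : 'End(Z)) (tauh_order2 : isometry_of_order tauh 2)
  (n : nat -> Z) (m : nat -> Y) (E : seq Y)
  (pi2 : quotient_map (tau \o tau)%VF 2 (eight n))
  (pi4 : quotient_map tau 4 E)
  (pi2h : quotient_map tauh 2 (eight m))
  (pi4_comp : forall x, rpush pi4 x = rpush pi2h (rpush pi2 x))
  (tauh_induced : forall x, tauh (rpush pi2 x) = rpush pi2 (tau x))
  (nikulin_n : nikulin_curves n) (nikulin_m : nikulin_curves m)
  (m_sub_E : {subset eight m <= E})
  (w : frame X) (w_marking : marking tau w)
  (generated_Z : eq_sub (@integral Z)
     (sum_sub (sum_sub (img_sub (rpush pi2) (@integral X)) (nikulin_lattice n))
        (int_span [seq z_ tau w (rpush pi2) n i | i <- iota 1 6])))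
  (tauh_fixed :
     [/\ tauh (n 1%N) = n 1%N, tauh (n 2%N) = n 2%N,
         tauh (n 6%N) = n 6%N & tauh (n 7%N) = n 7%N])
  (tauh_swapped :
     [/\ tauh (n 3%N) = n 4%N, tauh (n 4%N) = n 3%N,
         tauh (n 5%N) = n 8%N & tauh (n 8%N) = n 5%N]) :
  let hat : 'Hom(X, Z) := rpush pi2 in
  let bar : 'Hom(X, Y) := rpush pi4 in
  let push2h : 'Hom(Z, Y) := rpush pi2h in
  let z : nat -> Z := z_ tau w hat n in
  let M : Y -> Prop := primitive_closure E in
  let NY : Y -> Prop := primitive_closure (eight m) in
  (* 1 *)
  [/\ unique
        (fun phi : 'Hom(Y, X) =>
           [/\ forall x, M x -> phi x = 0,
               forall i, (1 <= i <= 4)%N ->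
                 phi (bar (e_ w i)) = e_ w i + f_ w i + g_ w i + h_ w i,
               phi (bar (a_ w 1)) = 2%:R *: a_ w 1 + 2%:R *: a_ w 2,
               phi (bar (rho w)) = 4%:R *: rho w
             & phi (bar (omega_ w 1)) = 4%:R *: omega_ w 1 /\
               phi (bar (omega_ w 2)) = 4%:R *: omega_ w 2])
        (rpull pi4),
      ((forall i, (1 <= i <= 4)%N ->
          [/\ bar (f_ w i) = bar (e_ w i), bar (g_ w i) = bar (e_ w i)
            & bar (h_ w i) = bar (e_ w i)]) /\
       bar (a_ w 2) = bar (a_ w 1)),
      [/\ bar (alphaX w) = 4^-1 *: bar (rho w) + bar (e_ w 1)
                          + 2^-1 *: (bar (e_ w 2) + bar (e_ w 4)),
          bar (chiX w) = 2^-1 *: bar (rho w),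
          bar (zetaX w) = bar (e_ w 1)
             + 2^-1 *: (bar (e_ w 2) + bar (e_ w 4) + bar (a_ w 1)
                        + bar (omega_ w 1))
        & bar (etaX w) = bar (e_ w 1)
             + 2^-1 *: (bar (e_ w 2) + bar (e_ w 4) + bar (a_ w 1)
                        + bar (omega_ w 2))],
      eq_sub (img_sub bar (@integral X))
        (sum_sub (img_sub bar (int_span (W_basis w)))
           (int_span [:: bar (alphaX w); bar (chiX w); bar (zetaX w);
                         bar (etaX w)]))
    & direct_sub (img_sub bar (@integral X)) M /\
      finite_index (sum_sub (img_sub bar (@integral X)) M) (@integral Y)]
  /\
  (* 2 *)
  [/\ unique
        (fun phi : 'Hom(Z, X) =>
           [/\ forall x, nikulin_lattice n x -> phi x = 0,
               forall i, (1 <= i <= 4)%N ->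
                 phi (hat (e_ w i)) = e_ w i + g_ w i /\
                 phi (hat (f_ w i)) = f_ w i + h_ w i,
               phi (hat (a_ w 1)) = 2%:R *: a_ w 1 /\
               phi (hat (a_ w 2)) = 2%:R *: a_ w 2,
               phi (hat (sigma w)) = 2%:R *: sigma w /\
               phi (hat (rho w)) = 2%:R *: rho w
             & phi (hat (omega_ w 1)) = 2%:R *: omega_ w 1 /\
               phi (hat (omega_ w 2)) = 2%:R *: omega_ w 2])
        (rpull pi2),
      (forall i, (1 <= i <= 4)%N ->
         hat (g_ w i) = hat (e_ w i) /\ hat (h_ w i) = hat (f_ w i)),
      ([/\ hat (alphaX w) = 4^-1 *: (hat (rho w) + hat (sigma w))
             + 2^-1 *: (hat (e_ w 1) + hat (e_ w 2) + hat (f_ w 1)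
                        + hat (f_ w 4)),
           hat (betaX tau w) = 4^-1 *: (hat (rho w) - hat (sigma w))
             + 2^-1 *: (hat (e_ w 1) + hat (e_ w 4) + hat (f_ w 1)
                        + hat (f_ w 2))
         & hat (epsilonX w) = 2^-1 *: hat (rho w) + hat (f_ w 2) + hat (f_ w 4)
             + 2^-1 *: (hat (a_ w 1) + hat (a_ w 2))] /\
       [/\ hat (chiX w) = 2^-1 *: (hat (rho w) + hat (sigma w)),
           hat (zetaX w) = 2^-1 *: (hat (e_ w 1) + hat (f_ w 1) + hat (e_ w 4)
                                   + hat (f_ w 2) + hat (a_ w 1)
                                   + hat (omega_ w 1))
         & hat (etaX w) = 2^-1 *: (hat (e_ w 1) + hat (f_ w 1) + hat (e_ w 4)
                                  + hat (f_ w 2) + hat (a_ w 2)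
                                  + hat (omega_ w 2))]),
      eq_sub (img_sub hat (@integral X))
        (sum_sub (img_sub hat (int_span (W_basis w)))
           (int_span [:: hat (alphaX w); hat (betaX tau w); hat (epsilonX w);
                         hat (chiX w); hat (zetaX w); hat (etaX w)]))
    & [/\ direct_sub (img_sub hat (@integral X)) (nikulin_lattice n),
          finite_index
            (sum_sub (img_sub hat (@integral X)) (nikulin_lattice n))
            (@integral Z)
        & eq_sub (@integral Z)
            (sum_sub
               (sum_sub (img_sub hat (@integral X)) (nikulin_lattice n))
               (int_span [:: z 1%N; z 2%N; z 3%N; z 4%N; z 5%N; z 6%N]))]]
  /\
  (* 3 *)
  [/\ unique
        (fun phi : 'Hom(Y, Z) =>
           [/\ forall x, NY x -> phi x = 0,
               forall i, (1 <= i <= 4)%N ->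
                 phi (bar (e_ w i)) = hat (e_ w i) + hat (f_ w i),
               [/\ phi (bar (alphaX w)) = hat (alphaX w) + hat (betaX tau w),
                   phi (bar (a_ w 1)) = hat (a_ w 1) + hat (a_ w 2),
                   phi (bar (chiX w)) = 2^-1 *: phi (bar (rho w))
                 & 2^-1 *: phi (bar (rho w)) = hat (rho w)],
               [/\ phi (bar (zetaX w)) = hat (e_ w 1) + hat (f_ w 1)
                     + 2^-1 *: (hat (e_ w 2) + hat (f_ w 2) + hat (e_ w 4)
                                + hat (f_ w 4) + hat (a_ w 1) + hat (a_ w 2)
                                + 2%:R *: hat (omega_ w 1)),
                   phi (bar (etaX w)) = hat (e_ w 1) + hat (f_ w 1)
                     + 2^-1 *: (hat (e_ w 2) + hat (f_ w 2) + hat (e_ w 4)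
                                + hat (f_ w 4) + hat (a_ w 1) + hat (a_ w 2)
                                + 2%:R *: hat (omega_ w 2)),
                   phi (push2h (n 6%N)) = 2%:R *: n 6%N
                 & phi (push2h (half_sum n)) = 2%:R *: half_sum n]
             & [/\ phi (push2h (z 1%N)) =
                     2^-1 *: (hat (alphaX w) + hat (betaX tau w)
                              + hat (e_ w 1) + hat (f_ w 1)
                              + hat (e_ w 2) + hat (f_ w 2)
                              + hat (a_ w 1) + hat (a_ w 2)
                              + phi (bar (etaX w))
                              + 2%:R *: n 2%N + n 5%N + n 8%N),
                   phi (push2h (z 2%N)) =
                     2^-1 *: (hat (rho w) + hat (e_ w 2) + hat (f_ w 2)
                              + hat (e_ w 4) + hat (f_ w 4)
                              + hat (a_ w 1) + hat (a_ w 2)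
                              + n 3%N + n 4%N + n 5%N + n 8%N),
                   phi (push2h (z 5%N)) =
                     2^-1 *: (hat (alphaX w) + hat (betaX tau w)
                              + hat (e_ w 1) + hat (f_ w 1)
                              + hat (e_ w 2) + hat (f_ w 2)
                              + hat (rho w) + phi (bar (etaX w))
                              + 2%:R *: n 6%N + n 5%N + n 8%N)
                     + hat (rho w)
                 & phi (push2h (z 6%N)) =
                     2^-1 *: (hat (alphaX w) + hat (betaX tau w)
                              + hat (e_ w 1) + hat (f_ w 1)
                              + hat (e_ w 4) + hat (f_ w 4)
                              + hat (rho w) + phi (bar (zetaX w))
                              + 2%:R *: n 7%N + n 5%N + n 8%N)
                     + hat (a_ w 1) + hat (a_ w 2)
                     + hat (e_ w 2) + hat (f_ w 2) + hat (rho w)]])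
        (rpull pi2h),
      eq_sub (img_sub push2h (@integral Z))
        (int_span [:: bar (e_ w 1); bar (alphaX w); bar (e_ w 3); bar (e_ w 4);
                      bar (a_ w 1); bar (chiX w); bar (zetaX w); bar (etaX w);
                      push2h (n 6%N); push2h (half_sum n);
                      push2h (z 1%N); push2h (z 2%N); push2h (z 5%N);
                      push2h (z 6%N)]),
      (forall i, (1 <= i <= 6)%N ->
         rpull pi2h (push2h (z i)) = z i + tauh (z i))
    & direct_sub (img_sub push2h (@integral Z)) NY /\
      finite_index (sum_sub (img_sub push2h (@integral Z)) NY) (@integral Y)].
Proof.
move=> hat bar push2h z M NY.
have hat_tau2 x : hat (tau (tau x)) = hat x.
  by rewrite -(rpush_invariant pi2 x) comp_lfunE.
have bar_tau x : bar (tau x) = bar x by apply: rpush_invariant.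
have push_tauh y : push2h (tauh y) = push2h y by apply: rpush_invariant.
have barE x : push2h (hat x) = bar x by rewrite /bar pi4_comp.
have pull4 x : rpull pi4 (bar x) = x + tau x + tau (tau x) + tau (tau (tau x)).
  by rewrite rpull_rpush // !big_ord_recr big_ord0 /= add0r.
have pull2 x : rpull pi2 (hat x) = x + tau (tau x).
  by rewrite rpull_rpush // !big_ord_recr big_ord0 /= add0r comp_lfunE.
have pull2h y : rpull pi2h (push2h y) = y + tauh y.
  by rewrite rpull_rpush // !big_ord_recr big_ord0 /= add0r.
have int_n : {in eight n, forall c, integral c} by case: (E_exceptional pi2).
have tauE := tau_frame w_marking.
have tau2_sigma : tau (tau (sigma w)) = sigma w.
  by rewrite tauE linearN /= tauE opprK.
split; [|split].
- split; last exact: primitive_closure_finite_index.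
  + split=> [|phi [phiM phi_e phi_a phi_rho [phi_o1 phi_o2]]].
      split=> [y|i i14|||]; [exact: rpull_primitive_closure|..|split];
        by rewrite pull4 !tauE //; linear_eq.
    (* Uniqueness: [M] contains the curves of [E], and on push-forwards the values at the basis of W
       decide. *)
    apply: (eq_rpush_E (q := pi4)) => // [c Ec|x].
      have Mc : M c by apply: mem_primitive_closure.
      by rewrite phiM // (rpull_primitive_closure pi4 Mc).
    move: x; apply: (eq_comp_W_basis w_marking).
    apply: W_basis_ind => [i i14||||||].
    * rewrite (bar_f w_marking bar_tau) // (bar_g w_marking bar_tau) //.
      by rewrite (bar_h w_marking bar_tau) // phi_e // pull4 !tauE.
    * by rewrite phi_a pull4 !tauE; linear_eq.
    * by rewrite (bar_a2 w_marking bar_tau) phi_a pull4 !tauE; linear_eq.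
    (* No value is prescribed here: the image of [sigma] is 0. *)
    * by rewrite (bar_sigma w_marking bar_tau) !linear0.
    * by rewrite phi_rho pull4 !tauE; linear_eq.
    * by rewrite phi_o1 pull4 !tauE; linear_eq.
    * by rewrite phi_o2 pull4 !tauE; linear_eq.
  + split=> [i i14|]; last exact: (bar_a2 w_marking).
    by split; [apply: (bar_f w_marking) | apply: (bar_g w_marking)
      | apply: (bar_h w_marking)].
  + by split; [apply: (bar_alpha w_marking) | apply: (bar_chi w_marking)
      | apply: (bar_zeta w_marking) | apply: (bar_eta w_marking)].
  + exact: (bar_integral w_marking).
- split.
  + split=> [|phi [phiN phi_ef [phi_a1 phi_a2] [phi_s phi_rho]]];
      last case=> phi_o1 phi_o2.
      split=> [y /nikulin_span/rpull_span_E//|i i14|||]; split;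
        by rewrite pull2 ?tau2_sigma ?tauE //; linear_eq.
    apply: (eq_rpush_E (q := pi2)) => // [c nc|x].
      have [i i18 ->] := eightP nc.
      rewrite phiN; last exact: nikulin_mem.
      by rewrite rpull_span_E ?memv_span ?mem_eight.
    move: x; apply: (eq_comp_W_basis w_marking).
    apply: W_basis_ind => [i i14||||||].
    * rewrite (hat_g w_marking hat_tau2) // (hat_h w_marking hat_tau2) //.
      by have [-> ->] := phi_ef i i14; rewrite !pull2 !tauE.
    * by rewrite phi_a1 pull2 !tauE; linear_eq.
    * by rewrite phi_a2 pull2 !tauE; linear_eq.
    * by rewrite phi_s pull2 tau2_sigma; linear_eq.
    * by rewrite phi_rho pull2 !tauE; linear_eq.
    * by rewrite phi_o1 pull2 !tauE; linear_eq.
    * by rewrite phi_o2 pull2 !tauE; linear_eq.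
  + move=> i i14.
    by split; [apply: (hat_g w_marking) | apply: (hat_h w_marking)].
  + by split; split; [apply: hat_alpha | apply: (hat_beta w_marking)
      | apply: (hat_epsilon w_marking) | apply: hat_chi | apply: hat_zeta
      | apply: hat_eta].
  + exact: (hat_integral w_marking).
  + split; last exact: generated_Z.
      by apply: rpush_direct => // y; apply: nikulin_span.
    (* The factor 2 is that of [nikulin_double]: the Nikulin lattice is given by generators here,
       not as a primitive closure. *)
    apply: (@rpush_finite_index _ _ _ _ _ pi2 _ _ 2) => // [|y|y].
    * exact: int_span_subgroup.
    * exact: nikulin_integral.
    * exact: nikulin_double.
have tauh_hat x : tauh (hat x) = hat (tau x) by apply: tauh_induced.
have int_hat x : integral x -> integral (hat x) by apply: rpush_integral.
have int_ni i : (1 <= i <= 8)%N -> integral (n i) by move/mem_eight/int_n.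
have [_ int_nu] := nikulin_n; have [n1 n2 n6 n7] := tauh_fixed.
have gens := push_integral_basis w_marking tauh_hat tauh_swapped
  push_tauh int_hat int_ni int_nu generated_Z barE.
split=> [|//|i _|]; last exact: primitive_closure_finite_index.
  2: exact: pull2h.
set Q := fun phi : 'Hom(Y, Z) => _.
have Q_pull : Q (rpull pi2h).
  (* Seen as push-forwards from Z, all the arguments have their trace under [tauh] as value. *)
  rewrite /Q -!barE !pull2h; split=> [y|i i14||| ].
  - exact: rpull_primitive_closure.
  - by rewrite -barE pull2h; apply: (trace_e w_marking).
  - have half_rho : 2^-1 *: (hat (rho w) + tauh (hat (rho w))) = hat (rho w).
      by rewrite tauh_hat tauE; linear_eq.
    split; rewrite ?half_rho ?(trace_chi w_marking tauh_hat) //;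
      by rewrite tauh_hat ?tauE.
  - split; [exact: (trace_zeta w_marking) | exact: (trace_eta w_marking)| |].
      by rewrite n6; linear_eq.
    exact: trace_half_sum.
  - by split; [apply: (trace_z1 w_marking) | apply: (trace_z2 w_marking)
      | apply: (trace_z5 w_marking) | apply: trace_z6].
split=> // phi Q_phi.
apply: (eq_rpush_E (q := pi2h)) => // [c mc|y].
  have NYc : NY c by apply: mem_primitive_closure.
  case: Q_phi => phiNY _ _ _ _.
  by rewrite phiNY // (rpull_primitive_closure pi2h NYc).
(* On the image of the integral classes it suffices to compare the two maps at the fourteen
   generators. *)
have eq_gens c : img_sub push2h (@integral Z) c -> rpull pi2h c = phi c.
  move/gens; apply: (int_span_min (equalizer_subgroup _ _)) => {}c.
  case: Q_pull => _ q_e [q_al q_a q_ch q_rh] [q_ze q_et q_n6 q_nu].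
  case=> q_z1 q_z2 q_z5 q_z6.
  case: Q_phi => _ p_e [p_al p_a p_ch p_rh] [p_ze p_et p_n6 p_nu].
  case=> p_z1 p_z2 p_z5 p_z6.
  rewrite !inE; do 13?[case/orP=> [/eqP->|]]; try move/eqP->.
  - by rewrite q_e ?p_e.
  - by rewrite q_al p_al.
  - by rewrite q_e ?p_e.
  - by rewrite q_e ?p_e.
  - by rewrite q_a p_a.
  - by rewrite q_ch p_ch q_rh p_rh.
  - by rewrite q_ze p_ze.
  - by rewrite q_et p_et.
  - by rewrite q_n6 p_n6.
  - by rewrite q_nu p_nu.
  - by rewrite q_z1 p_z1 q_et p_et.
  - by rewrite q_z2 p_z2.
  - by rewrite q_z5 p_z5 q_et p_et.
  - by rewrite q_z6 p_z6 q_ze p_ze.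
(* Composed with the push-forward, both maps are linear on Z, so agreement at integral classes gives
   agreement everywhere. *)
rewrite -[LHS]comp_lfunE -[RHS]comp_lfunE; congr (fun_of_lfun _ y).
apply: eq_integral => u iu; rewrite [LHS]comp_lfunE [RHS]comp_lfunE.
by apply: eq_gens; exists u.
Qed.
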